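(* Let $(X,\varphi)$ and $(Y,\psi)$ be Cantor minimal systems, and let $x\in X$ and $y\in Y$. Let $C$ and $B$ be Bratteli–Vershik models for $(X,\varphi,x)$ and $(Y,\psi,y)$, respectively. The following statements are equivalent: (1) there is a factor map $\alpha:(X,\varphi)\to(Y,\psi)$ with $\alpha(x)=y$; (2) there is an ordered premorphism $f$ from $B$ to $C$. More precisely, identifying $(X,\varphi,x)$ with $(X_C,\lambda_C,x_{\max})$ and $(Y,\psi,y)$ with $(X_B,\lambda_B,x_{\max})$ via fixed pointed conjugacies, $[f]\mapsto\mathcal{V}([f])$ is a one-to-one correspondence between the set of equivalence classes $[f]$ of ordered premorphisms $f$ from $B$ to $C$ and the set of factor maps $\alpha$ as in (1).
   Context: A Cantor minimal system $(X,\varphi)$ is a minimal homeomorphism $\varphi$ of a space $X$ homeomorphic to the Cantor set. A factor map $(X,\varphi)\to(Y,\psi)$ is a continuous surjection $\alpha:X\to Y$ with $\alpha\circ\varphi=\psi\circ\alpha$. **Bratteli diagrams.** A Bratteli diagram $(V,E)$ consists of a vertex set $V=V_0\sqcup V_1\sqcup\cdots$ with each $V_n$ finite and non-empty and $V_0$ a singleton, and an edge set $E=E_1\sqcup E_2\sqcup\cdots$ with each $E_n$ finite and non-empty, together with maps $r,s:E\to V$ (range, source) such that $r(E_n)\subseteq V_n$, $s(E_n)\subseteq V_{n-1}$, $s^{-1}\{v\}\neq\varnothing$ for all $v\in V$ and $r^{-1}\{v\}\ne\varnothing$ for all $v\in V\setminus V_0$. An ordered Bratteli diagram $(V,E,\geq)$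 is a Bratteli diagram with a partial order on $E$ such that $e,e'$ are comparable iff $r(e)=r(e')$. It is properly ordered if there is exactly one infinite path $x_{\max}=(e_1,e_2,\ldots)$ ($e_i\in E_i$, $r(e_i)=s(e_{i+1})$) consisting of maximal edges, and exactly one, $x_{\min}$, consisting of minimal edges. For $B$ properly ordered, $X_B$ is the space of infinite paths, with the cylinder sets as a basis of the topology, and the Vershik homeomorphism $\lambda_B$ is given by $\lambda_B(x_{\max})=x_{\min}$ and, for other $x=(e_1,e_2,\ldots)$, with $k$ least such that $e_k$ is not maximal, $f_k$ the successor of $e_k$ in $r^{-1}\{r(e_k)\}$ and $(f_1,\ldots,f_{k-1})$ the path of minimal edges from $V_0$ to $s(f_k)$, by $\lambda_B(x)=(f_1,\ldots,f_k,e_{k+1},\ldots)$. **Bratteli–Vershik models.** A Bratteli–Vershik model for $(X,\varphi,x_0)$ is a properly ordered Bratteli diagram $B$ for which there is a homeomorphism $\theta:X\to X_B$ with $\theta\circ\varphi=\lambda_B\circ\theta$ and $\theta(x_0)=x_{\max}$ (a pointed conjugacy). **Edge sets.** An ordered edge set from a finite set $S$ to a finite set $T$ is a finite set $F$ with maps $s:F\to S$, $r:F\to T$ and a linear order on each $r^{-1}\{w\}$, $w\in T$. If $G$ is an ordered edge set from $T$ to $U$, then $F\circ G=\{(e,g)\in F\times G: r(e)=s(g)\}$, with source $s(e)$, range $r(g)$, and order: for $r(g)=r(g')$, $(e,g)<(e',g')$ iff $g<g'$, or $g=g'$ and $e<e'$. Write $F\cong F'$ if there is a (necessarily unique) bijection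 $F\to F'$ preserving sources, ranges and order. For $k<l$, $E_{k,l}=E_{k+1}\circ\cdots\circ E_l$; $E_{k,k}$ consists of one edge from $v$ to $v$ for each $v\in V_k$. **Ordered premorphisms.** An ordered premorphism $f:B=(V,E,\ge)\to C=(W,S,\ge)$ is a triple $(F,(f_n)_{n\ge0},\geq)$ where $(f_n)$ is an unbounded sequence of integers with $0=f_0\le f_1\le\cdots$, and $F=F_0\sqcup F_1\sqcup\cdots$ where each $F_n$ is a non-empty finite ordered edge set from $V_n$ to $W_{f_n}$ such that every $v\in V_n$ is the source and every $w\in W_{f_n}$ the range of some edge of $F_n$, $F_0$ is a singleton, and $E_{n+1}\circ F_{n+1}\cong F_n\circ S_{f_n,f_{n+1}}$ for all $n\ge0$. Premorphisms $f=(F,(f_n),\ge)$, $g=(G,(g_n),\ge)$ from $B$ to $C$ are equivalent if there are positive integers $n_1<m_1<n_2<m_2<\cdots$ with $f_{n_k}<g_{m_k}<f_{n_{k+1}}$ and, for all $k\ge1$, $E_{n_k,m_k}\circ G_{m_k}\cong F_{n_k}\circ S_{f_{n_k},g_{m_k}}$ and $E_{m_k,n_{k+1}}\circ F_{n_{k+1}}\cong G_{m_k}\circ S_{g_{m_k},f_{n_{k+1}}}$; $[f]$ denotes the class of $f$. **The map $\mathcal{V}([f])$.** For an ordered premorphism $f=(F,(f_n)_{n\ge0},\geq)$ from a properly ordered Bratteli diagram $B=(V,E,\ge)$ to a properly ordered Bratteli diagram $C=(W,S,\ge)$, with $F=F_0\sqcup F_1\sqcup\cdots$ and each $F_n$ an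 ordered edge set from $V_n$ to $W_{f_n}$, $\mathcal{V}([f]):X_C\to X_B$ is the following map (depending only on $[f]$). For $x=(s_1,s_2,\ldots)\in X_C$ and $n\ge1$, let $s_0$ be the unique element of $F_0$ and let $(e_1,\ldots,e_n,d_n)\in E_{0,n}\circ F_n$ be the path corresponding to $(s_0,s_1,\ldots,s_{f_n})\in F_0\circ S_{0,f_n}$ under the unique isomorphism $F_0\circ S_{0,f_n}\cong E_{0,n}\circ F_n$; the edges $e_1,\ldots,e_n$ are consistent as $n$ varies, and $\mathcal{V}([f])(x)=(e_1,e_2,\ldots)$. *)

(* Defs.v *)
From HB Require Import structures.
From mathcomp Require Import all_boot.
From mathcomp Require Import boolp classical_sets functions.
From mathcomp Require Import topology cantor.

Set Implicit Arguments.
Unset Strict Implicit.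
Unset Printing Implicit Defensive.

Local Open Scope classical_set_scope.
Local Open Scope nat_scope.

Definition homeomorphism (X Y : topologicalType) (f : X -> Y) : Prop :=
  exists g : Y -> X,
    [/\ cancel f g, cancel g f, continuous f & continuous g].

Definition minimal_homeomorphism (X : topologicalType) (phi : X -> X) : Prop :=
  homeomorphism phi /\
  forall A : set X, closed A -> phi @` A = A -> A = set0 \/ A = setT.

Definition cantor_minimal (X : topologicalType) (phi : X -> X) : Prop :=
  (exists h : X -> cantor_space, homeomorphism h) /\
  minimal_homeomorphism phi.

Definition factor_map (X Y : topologicalType) (phi : X -> X) (psi : Y -> Y)
    (alpha : X -> Y) : Prop :=
  [/\ continuous alpha, set_surj setT setT alpha
    & forall z, alpha (phi z) = psi (alpha z)].

(* The linear orders on the fibres of the range map are given together, as one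
   partial order on all edges in which exactly the edges of equal range are
   comparable. *)
Record oedges (S T : finType) := OEdges {
  oedge :> finType;
  src : oedge -> S;
  rng : oedge -> T;
  ole : rel oedge;
  ole_refl : reflexive ole;
  ole_anti : antisymmetric ole;
  ole_trans : transitive ole;
  ole_comparable : forall e e', ole e e' || ole e' e = (rng e == rng e')
}.

Section OrderedEdges.
Context {S T : finType}.

Definition maximal_edge (F : oedges S T) (e : F) : Prop :=
  forall e', ole e e' -> e' = e.

Definition minimal_edge (F : oedges S T) (e : F) : Prop :=
  forall e', ole e' e -> e' = e.

Definition successor_edge (F : oedges S T) (e f : F) : Prop :=
  [/\ ole e f, f != e & forall g, ole e g -> g != e -> ole f g].

Definition is_oiso (F G : oedges S T) (h : F -> G) : Prop :=
  [/\ bijective h,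
      forall e, src (h e) = src e,
      forall e, rng (h e) = rng e
    & forall e e', ole (h e) (h e') = ole e e'].

Definition oiso (F G : oedges S T) : Prop := exists h : F -> G, is_oiso h.

Lemma ole_rng (F : oedges S T) (e e' : F) : ole e e' -> rng e = rng e'.
Proof. by move=> ee'; apply/eqP; rewrite -ole_comparable ee'. Qed.

End OrderedEdges.

Section Identity.
Variable S : finType.

Fact id_comparable (e e' : S) : (e == e') || (e' == e) = (e == e').
Proof. by rewrite (eq_sym e') orbb. Qed.

Fact id_anti : antisymmetric (@eq_op S).
Proof. by move=> e e' /andP[/eqP]. Qed.

Definition id_oedges : oedges S S :=
  @OEdges S S S id id eq_op (@eqxx S) id_anti (@eq_op_trans S) id_comparable.

End Identity.

Definition empty_oedges (S T : finType) : oedges S T.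
Proof.
by refine (@OEdges S T void (of_void S) (of_void T) eq_op _ _ _ _); case.
Defined.

Section Composition.
Context {S T U : finType} (F : oedges S T) (G : oedges T U).

Definition comp_edge : finType := {p : F * G | rng p.1 == src p.2}.

Definition comp_src (p : comp_edge) : S := src (val p).1.

Definition comp_rng (p : comp_edge) : U := rng (val p).2.

Definition comp_ole (p q : comp_edge) : bool :=
  ((val p).2 != (val q).2) && ole (val p).2 (val q).2
  || ((val p).2 == (val q).2) && ole (val p).1 (val q).1.

Fact comp_ole_refl : reflexive comp_ole.
Proof. by move=> p; rewrite /comp_ole eqxx /= ole_refl. Qed.

Fact comp_ole_anti : antisymmetric comp_ole.
Proof.
move=> [[e g] /= p] [[e' g'] /= q]; rewrite /comp_ole /=.
have [gg|gg] := eqVneq g g'; rewrite /= ?orbF.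
  move=> ee; apply: val_inj => /=; rewrite gg; congr (_, _).
  exact: (@ole_anti _ _ F).
by move=> /(@ole_anti _ _ G) /eqP; rewrite (negbTE gg).
Qed.

Fact comp_ole_trans : transitive comp_ole.
Proof.
move=> [[e' g'] /= q] [[e g] /= p] [[e'' g''] /= r]; rewrite /comp_ole /=.
have [->|gg'] := eqVneq g g'; have [<-|gg''] := eqVneq g' g''; rewrite /= ?eqxx ?orbF //=.
- exact: ole_trans.
- by rewrite gg' => ->.
have [gg|_] := eqVneq g g'' => /=; last by rewrite orbF; exact: ole_trans.
rewrite -gg in gg'' *; move=> a b.
by have /eqP := ole_anti (introT andP (conj a b)); rewrite (negbTE gg').
Qed.

Fact comp_ole_comparable p q :
  comp_ole p q || comp_ole q p = (comp_rng p == comp_rng q).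
Proof.
move: p q => [[e g] /= p] [[e' g'] /= q]; rewrite /comp_ole /comp_rng /=.
have [gg|gg] := eqVneq g g' => /=; last by rewrite !orbF ole_comparable.
rewrite ole_comparable gg eqxx; apply/eqP.
by rewrite (eqP p) (eqP q) /= gg.
Qed.

Definition comp_oedges : oedges S U :=
  OEdges comp_src comp_ole_refl comp_ole_anti comp_ole_trans comp_ole_comparable.

End Composition.

Notation "F \oe G" := (comp_oedges F G) (at level 40, left associativity).

Fixpoint span0 (V : nat -> finType) (E : forall n, oedges (V n) (V n.+1))
    (l : nat) : oedges (V 0) (V l) :=
  match l return oedges (V 0) (V l) with
  | 0 => id_oedges (V 0)
  | m.+1 => span0 E m \oe E m
  end.

(* E_{k,l}; the value for l < k is a dummy. *)
Fixpoint span (V : nat -> finType) (E : forall n, oedges (V n) (V n.+1))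
    (k : nat) : forall l, oedges (V k) (V l) :=
  match k return forall l, oedges (V k) (V l) with
  | 0 => span0 E
  | k'.+1 => fun l => match l return oedges (V k'.+1) (V l) with
    | 0 => empty_oedges (V k'.+1) (V 0)
    | l'.+1 => @span (fun n => V n.+1) (fun n => E n.+1) k' l'
    end
  end.

(* [edges n] is the n.+1-st edge set, from level n to level n.+1. *)
Record bratteli := Bratteli {
  vertex : nat -> finType;
  edges : forall n, oedges (vertex n) (vertex n.+1);
  vertex_neq0 : forall n, 0 < #|vertex n|;
  vertex0_singleton : #|vertex 0| = 1;
  edges_neq0 : forall n, 0 < #|edges n|;
  src_surj : forall n (v : vertex n), exists e : edges n, src e = v;
  rng_surj : forall n (v : vertex n.+1), exists e : edges n, rng e = v
}.

Record bpath (B : bratteli) := BPath {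
  bedge :> forall n, edges B n;
  bpathP : forall n, rng (bedge n) = src (bedge n.+1)
}.

Definition max_path (B : bratteli) (x : bpath B) : Prop :=
  forall n, maximal_edge (x n).

Definition min_path (B : bratteli) (x : bpath B) : Prop :=
  forall n, minimal_edge (x n).

Record proper_bratteli := ProperBratteli {
  bratteli_of :> bratteli;
  max_path_unique : exists! x : bpath bratteli_of, max_path x;
  min_path_unique : exists! x : bpath bratteli_of, min_path x
}.

Lemma singleton_eq (T : finType) (a b : T) : #|T| = 1 -> a = b.
Proof. by move=> /eq_leq/fintype_le1P/(_ b). Qed.

Section PathSpace.
Variable B : bratteli.
Implicit Types x y : bpath B.

Lemma bpath_eq x y : (forall n, x n = y n) -> x = y.
Proof.
case: x y => [x px] [y py] /= xy.
have {}xy : x = y by apply: functional_extensionality_dep.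
by case: y / xy py => py; congr BPath; exact: Prop_irrelevance.
Qed.

HB.instance Definition _ := gen_eqMixin (bpath B).
HB.instance Definition _ := gen_choiceMixin (bpath B).

Fixpoint prefix_spec x (n : nat) :
    {p : span0 (edges B) n | rng p = src (x n)} :=
  match n return {p : span0 (edges B) n | rng p = src (x n)} with
  | 0 => exist _ (src (x 0) : span0 (edges B) 0) erefl
  | m.+1 => let: exist p rp := prefix_spec x m in
      exist (fun p : span0 (edges B) m.+1 => rng p = src (x m.+1))
        (exist _ (p, x m) (introT eqP rp)) (bpathP x m)
  end.

(* (x_1, ..., x_n) as an element of E_{0,n} *)
Definition prefix x n : span0 (edges B) n := sval (prefix_spec x n).

Lemma rng_prefix x n : rng (prefix x n) = src (x n).
Proof. exact: svalP (prefix_spec x n). Qed.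

Lemma val_prefixS x n : val (prefix x n.+1) = (prefix x n, x n).
Proof. by rewrite /prefix /=; case: (prefix_spec x n). Qed.

Lemma prefix_eqP x y n :
  prefix x n = prefix y n <-> forall i, i < n -> x i = y i.
Proof.
elim: n => [|n IH].
  split=> // _; rewrite /prefix /=.
  by apply: singleton_eq; exact: vertex0_singleton.
split=> [xy i|xy].
  have := val_prefixS x n; rewrite xy val_prefixS => -[p e].
  by rewrite ltnS leq_eqVlt => /predU1P[-> //|]; apply: (IH.1 (esym p)).
apply: val_inj; rewrite !val_prefixS xy//; congr (_, _).
by apply/IH => i ilt; apply: xy; exact: ltnW.
Qed.

Definition cylinder n (p : span0 (edges B) n) : set (bpath B) :=
  [set x | prefix x n = p].

Definition cylinders : set (set (bpath B)) :=
  [set A | exists n (p : span0 (edges B) n), A = cylinder p].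

Fact cylinders_cover : \bigcup_(A in cylinders) A = setT.
Proof.
rewrite -subTset => x _; exists (cylinder (prefix x 0)) => //.
by exists 0, (prefix x 0).
Qed.

Fact cylinders_join (A A' : set (bpath B)) x :
  cylinders A -> cylinders A' -> A x -> A' x ->
  exists A'', [/\ cylinders A'', A'' x & A'' `<=` A `&` A'].
Proof.
move=> [n [p ->]] [m [q ->]] /= <- <-.
exists (cylinder (prefix x (maxn n m))); split=> //.
  by exists (maxn n m), (prefix x (maxn n m)).
move=> y /prefix_eqP xy; split; apply/prefix_eqP => i ilt; apply: xy.
  by rewrite leq_max ilt.
by rewrite leq_max ilt orbT.
Qed.

HB.instance Definition _ :=
  isBaseTopological.Build (bpath B) cylinders_cover cylinders_join.

End PathSpace.

(* Since [x 0] is the first edge e_1 of the path, the index [k] is one less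
   than the index of the first non-maximal edge in the usual numbering. *)
Definition vershik_graph (B : bratteli) (x y : bpath B) : Prop :=
  max_path x /\ min_path y \/
  exists k, [/\ forall i, i < k -> maximal_edge (x i),
    ~ maximal_edge (x k),
    successor_edge (x k) (y k),
    forall i, i < k -> minimal_edge (y i)
  & forall i, k < i -> y i = x i].

Section Minimal.
Context {S T : finType} (F : oedges S T).

Lemma ole_min (P : pred F) e0 : P e0 ->
  exists2 e, P e & forall e', P e' -> ole e' e -> e' = e.
Proof.
move=> Pe0; pose d (e : F) := #|finset (fun e' => ole e' e)|.
have [e Pe emin] := arg_minnP d Pe0; exists e => // e' Pe' ee'.
apply/eqP; apply: contraT => ne; suff : d e' < d e by rewrite ltnNge emin.
apply/proper_card/properP; split.
  by apply/fintype.subsetP => z; rewrite !inE => /ole_trans; exact.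
exists e; rewrite !inE ?ole_refl//; apply: contra ne => e'e.
by apply/eqP/ole_anti/andP.
Qed.

Lemma minimal_edge_ex w : (exists e : F, rng e = w) ->
  exists2 e : F, rng e = w & minimal_edge e.
Proof.
move=> [e0 /eqP re0].
have [e /eqP re emin] := @ole_min (fun e => rng e == w) e0 re0.
by exists e => // e' ee'; apply: emin => //; rewrite (ole_rng ee') re.
Qed.

Lemma minimal_edge_inj (e f : F) :
  minimal_edge e -> minimal_edge f -> rng e = rng f -> e = f.
Proof.
move=> em fm /eqP; rewrite -ole_comparable => /orP[/fm //|/em //].
Qed.

Lemma successor_edge_ex (e : F) :
  ~ maximal_edge e -> exists f, successor_edge e f.
Proof.
move=> /existsNP[e' /not_implyP[ee' /eqP ne']].
have [f /andP[ef nf] fmin] :=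
  @ole_min (fun f => ole e f && (f != e)) e' (introT andP (conj ee' ne')).
exists f; split=> // g eg ng.
have : rng f == rng g by rewrite -(ole_rng ef) -(ole_rng eg).
rewrite -ole_comparable => /orP[//|gf].
by rewrite (fmin g) ?eg ?ole_refl.
Qed.

Lemma successor_edge_inj (e f g : F) :
  successor_edge e f -> successor_edge e g -> f = g.
Proof.
by move=> [ef nf fm] [eg ng gm]; apply/ole_anti; rewrite fm// gm.
Qed.

End Minimal.

Section Vershik.
Variable B : proper_bratteli.
Implicit Types x y z : bpath B.

Lemma min_completion k (z : forall n, edges B n) :
    (forall i, k <= i -> rng (z i) = src (z i.+1)) ->
  exists y, (forall i, k <= i -> y i = z i) /\
            (forall i, i < k -> minimal_edge (y i)).
Proof.
elim: k z => [|k IH] z zP; first by exists (BPath (fun i => zP i (leq0n i))).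
have [e re emin] := minimal_edge_ex (rng_surj (src (z k.+1))).
pose z' : forall n, edges B n :=
  @dfwith nat (fun n => edges B n : Type) z k e.
have z'k : z' k = e by exact: dfwith_in.
have z'N i : k != i -> z' i = z i by exact: dfwith_out.
have [i ik|y [yz ym]] := IH z'.
  rewrite (z'N i.+1) ?ltn_eqF// 1?ltnS//.
  have [ki|nki] := eqVneq k i; first by rewrite -ki z'k re.
  by rewrite z'N// zP// ltn_neqAle nki.
exists y; split=> i.
  by move=> ik; rewrite yz ?(ltnW ik)// z'N// ltn_eqF.
rewrite ltnS leq_eqVlt => /predU1P[->|]; last exact: ym.
by rewrite yz// z'k.
Qed.

Lemma min_prefix_unique x y k : src (x k) = src (y k) ->
    (forall i, i < k -> minimal_edge (x i)) ->
    (forall i, i < k -> minimal_edge (y i)) ->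
  forall i, i < k -> x i = y i.
Proof.
elim: k => [//|k IH] sk xm ym.
have xyk : x k = y k.
  by apply: minimal_edge_inj; [exact: xm|exact: ym|rewrite !bpathP].
move=> i; rewrite ltnS leq_eqVlt => /predU1P[-> //|].
by apply: IH; rewrite ?xyk// => j jk; [apply: xm|apply: ym]; exact: ltnW.
Qed.

Lemma vershik_ex x : exists y, vershik_graph x y.
Proof.
have [xm|/existsNP nmx] := pselect (max_path x).
  by have [y [ym _]] := min_path_unique B; exists y; left.
have ex : exists k, `[< ~ maximal_edge (x k) >].
  by have [k kx] := nmx; exists k; exact/asboolP.
have [k /asboolP nk kmin] := ex_minnP ex.
have [f sf] := successor_edge_ex nk.
pose z : forall n, edges B n :=
  @dfwith nat (fun n => edges B n : Type) x k f.
have zk : z k = f by exact: dfwith_in.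
have zN i : k != i -> z i = x i by exact: dfwith_out.
have [i ki|y [yz ym]] := @min_completion k z.
  rewrite (zN i.+1) ?ltn_eqF// -bpathP.
  have [<-|nki] := eqVneq k i; last by rewrite zN.
  by rewrite zk; case: sf => /ole_rng.
exists y; right; exists k; split=> //.
- move=> i ik; apply: contrapT => /asboolP /kmin.
  by rewrite leqNgt ik.
- by rewrite yz// zk.
- by move=> i ki; rewrite yz ?(ltnW ki)// zN// ltn_eqF.
Qed.

Lemma vershik_fun x y z : vershik_graph x y -> vershik_graph x z -> y = z.
Proof.
move=> [[xm ym]|[k [kmax nk ksucc kmin ktail]]];
  move=> [[xm' zm]|[l [lmax nl lsucc lmin ltail]]].
- have [w [_ wu]] := min_path_unique B.
  by rewrite -(wu y ym) (wu z zm).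
- by case: nl; exact: xm.
- by case: nk; exact: xm'.
have kl : k = l.
  case: (ltngtP k l) => // h; first by case: nk; exact: lmax.
  by case: nl; exact: kmax.
subst l; have yzk := successor_edge_inj ksucc lsucc.
apply: bpath_eq => i; case: (ltngtP i k) => [ik|ki|-> //].
  by apply: (min_prefix_unique _ kmin lmin) ik; rewrite yzk.
by rewrite ktail// ltail.
Qed.

Definition vershik x : bpath B := projT1 (cid (vershik_ex x)).

Lemma vershikP x : vershik_graph x (vershik x).
Proof. exact: projT2 (cid (vershik_ex x)). Qed.

End Vershik.

Definition pointed_conjugacy (X : topologicalType) (phi : X -> X) (x0 : X)
    (B : proper_bratteli) (theta : X -> bpath B) : Prop :=
  [/\ homeomorphism theta,
      forall z, theta (phi z) = vershik (theta z)
    & max_path (theta x0)].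

Definition bv_model (X : topologicalType) (phi : X -> X) (x0 : X)
    (B : proper_bratteli) : Prop :=
  exists theta : X -> bpath B, pointed_conjugacy phi x0 theta.

Definition from0 (u : nat -> nat) (n : nat) : nat :=
  if n is m.+1 then u m else 0.

(* The sequence (f_n) is [from0 pm_next], so that f_0 reduces to 0. *)
Record premorphism (B C : bratteli) := Premorphism {
  pm_next : nat -> nat;
  pm_edges : forall n, oedges (vertex B n) (vertex C (from0 pm_next n));
  pm_le : forall n, from0 pm_next n <= from0 pm_next n.+1;
  pm_unbounded : forall N, exists n, N < from0 pm_next n;
  pm_neq0 : forall n, 0 < #|pm_edges n|;
  pm_src_surj : forall n v, exists e : pm_edges n, src e = v;
  pm_rng_surj : forall n w, exists e : pm_edges n, rng e = w;
  pm_singleton : #|pm_edges 0| = 1;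
  pm_commute : forall n,
    oiso (edges B n \oe pm_edges n.+1)
         (pm_edges n \oe
          span (edges C) (from0 pm_next n) (from0 pm_next n.+1))
}.

Definition pm_level (B C : bratteli) (f : premorphism B C) : nat -> nat :=
  from0 (pm_next f).

Definition pm_square (B C : bratteli) (f g : premorphism B C) (n m : nat) :=
  oiso (span (edges B) n m \oe pm_edges g m)
       (pm_edges f n \oe span (edges C) (pm_level f n) (pm_level g m)).

Definition pm_equiv (B C : bratteli) (f g : premorphism B C) : Prop :=
  exists n m : nat -> nat,
  [/\ forall k, 0 < n k < m k,
      forall k, m k < n k.+1,
      forall k, pm_level f (n k) < pm_level g (m k) < pm_level f (n k.+1),
      forall k, pm_square f g (n k) (m k)
    & forall k, pm_square g f (m k) (n k.+1)].

(* A predicate rather than a [set]: [premorphism] contains finTypes and is too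
   large for the universe of the argument of [set]. *)
Definition pm_classes (B C : bratteli) :=
  {A : premorphism B C -> Prop | exists f, A = pm_equiv f}.

Definition pm_class (B C : bratteli) (f : premorphism B C) : pm_classes B C :=
  exist _ (pm_equiv f) (ex_intro _ f erefl).

(* [q] is (s_0, s_1, ..., s_{f_n}), where [(val q).1] is the only edge s_0 of
   F_0, and [(val (h q)).1] is (e_1, ..., e_n). *)
Definition pm_map_graph (B C : bratteli) (f : premorphism B C)
    (x : bpath C) (y : bpath B) : Prop :=
  forall n, 0 < n ->
  exists (h : pm_edges f 0 \oe span (edges C) 0 (pm_level f n) ->
              span (edges B) 0 n \oe pm_edges f n)
         (q : pm_edges f 0 \oe span (edges C) 0 (pm_level f n)),
  [/\ is_oiso h, (val q).2 = prefix x (pm_level f n)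
    & (val (h q)).1 = prefix y n].

Section Isomorphisms.
Context {S T : finType}.
Implicit Types F G H : oedges S T.

Lemma is_oiso_unique F G (h h' : F -> G) :
  is_oiso h -> is_oiso h' -> forall e, h e = h' e.
Proof.
have down (k : F -> G) e : is_oiso k ->
    #|finset (fun g => ole g (k e))| = #|finset (fun e' => ole e' e)|.
  move=> [kbij _ _ kole]; have [k' kK k'K] := kbij.
  rewrite -(card_imset _ (bij_inj kbij)); apply/eq_card => g.
  rewrite inE; apply/idP/imsetP => [gke|[e' + ->]]; last by rewrite inE kole.
  by exists (k' g); rewrite ?k'K// inE -kole k'K.
have le_eq (g g' : G) : ole g g' ->
    #|finset (fun z => ole z g)| = #|finset (fun z => ole z g')| -> g = g'.
  move=> gg' card.
  have /eqP eqd : finset (fun z => ole z g) == finset (fun z => ole z g').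
    rewrite eqEcard card leqnn andbT; apply/fintype.subsetP => z.
    by rewrite !inE => /ole_trans; exact.
  apply/ole_anti; rewrite gg' /=.
  have : g' \in finset (fun z => ole z g') by rewrite inE ole_refl.
  by rewrite -eqd inE.
move=> hi hi' e; have [_ _ hr _] := hi; have [_ _ hr' _] := hi'.
have : rng (h e) == rng (h' e) by rewrite hr hr'.
rewrite -ole_comparable => /orP[|] /le_eq; rewrite !down//.
  exact.
by move=> /(_ erefl).
Qed.

Lemma is_oiso_comp F G H (h : F -> G) (k : G -> H) :
  is_oiso h -> is_oiso k -> is_oiso (k \o h).
Proof.
move=> [hb hs hr ho] [kb ks kr ko]; split; first exact: bij_comp.
- by move=> e /=; rewrite ks hs.
- by move=> e /=; rewrite kr hr.
- by move=> e e' /=; rewrite ko ho.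
Qed.

Lemma is_oiso_inv F G (h : F -> G) (k : G -> F) :
  is_oiso h -> cancel h k -> cancel k h -> is_oiso k.
Proof.
move=> [hb hs hr ho] hK kK; split; first by exists h.
- by move=> e; rewrite -hs kK.
- by move=> e; rewrite -hr kK.
- by move=> e e'; rewrite -ho !kK.
Qed.

End Isomorphisms.

Section CompositionIsomorphisms.
Context {S T U W : finType}.

Lemma comp_edge_exists (F : oedges S T) (G : oedges T U) e g :
  rng e = src g -> exists p : F \oe G, val p = (e, g).
Proof. by move=> /eqP eg; exists (exist _ (e, g) eg). Qed.

Lemma oiso_compl (F F' : oedges S T) (G : oedges T U) (h : F -> F') :
  is_oiso h -> exists k : F \oe G -> F' \oe G,
  is_oiso k /\ forall p, val (k p) = (h (val p).1, (val p).2).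
Proof.
move=> hi; have [[h' hK h'K] hs hr ho] := hi.
have [_ hs' hr' ho'] := is_oiso_inv hi hK h'K.
have P (p : F \oe G) : rng (h (val p).1) == src (val p).2.
  by rewrite hr; exact: (valP p).
have P' (p : F' \oe G) : rng (h' (val p).1) == src (val p).2.
  by rewrite hr'; exact: (valP p).
exists (fun p => exist _ (h (val p).1, (val p).2) (P p)); split=> //; split.
- exists (fun p => exist _ (h' (val p).1, (val p).2) (P' p)) => p;
  by apply: val_inj => /=; rewrite ?hK ?h'K -surjective_pairing.
- by move=> p /=; rewrite /comp_src /= hs.
- by [].
- by move=> p q /=; rewrite /comp_ole /= ho.
Qed.

Lemma oiso_compr (F : oedges S T) (G G' : oedges T U) (h : G -> G') :
  is_oiso h -> exists k : F \oe G -> F \oe G',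
  is_oiso k /\ forall p, val (k p) = ((val p).1, h (val p).2).
Proof.
move=> hi; have [[h' hK h'K] hs hr ho] := hi.
have [_ hs' hr' ho'] := is_oiso_inv hi hK h'K.
have P (p : F \oe G) : rng (val p).1 == src (h (val p).2).
  by rewrite hs; exact: (valP p).
have P' (p : F \oe G') : rng (val p).1 == src (h' (val p).2).
  by rewrite hs'; exact: (valP p).
exists (fun p => exist _ ((val p).1, h (val p).2) (P p)); split=> //; split.
- exists (fun p => exist _ ((val p).1, h' (val p).2) (P' p)) => p;
  by apply: val_inj => /=; rewrite ?hK ?h'K -surjective_pairing.
- by [].
- by move=> p /=; rewrite /comp_rng /= hr.
- by move=> p q /=; rewrite /comp_ole /= ho (can_eq hK).
Qed.

Lemma oiso_assoc (F : oedges S T) (G : oedges T U) (H : oedges U W) :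
  exists k : F \oe (G \oe H) -> (F \oe G) \oe H,
  is_oiso k /\ forall p, [/\ (val (val (k p)).1).1 = (val p).1,
    (val (val (k p)).1).2 = (val (val p).2).1
  & (val (k p)).2 = (val (val p).2).2].
Proof.
have P (p : F \oe (G \oe H)) : rng (val p).1 == src (val (val p).2).1.
  exact: (valP p).
have Q (p : F \oe (G \oe H)) :
    rng (exist _ ((val p).1, (val (val p).2).1) (P p) : F \oe G) ==
    src (val (val p).2).2.
  exact: (valP (val p).2).
have P' (p : (F \oe G) \oe H) : rng (val (val p).1).2 == src (val p).2.
  exact: (valP p).
have Q' (p : (F \oe G) \oe H) : rng (val (val p).1).1 ==
    src (exist _ ((val (val p).1).2, (val p).2) (P' p) : G \oe H).
  exact: (valP (val p).1).
exists (fun p => exist _ (exist _ ((val p).1, (val (val p).2).1) (P p) : F \oe G,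
                          (val (val p).2).2) (Q p)); split=> //; split=> //.
  exists (fun p => exist _ ((val (val p).1).1,
      exist _ ((val (val p).1).2, (val p).2) (P' p) : G \oe H) (Q' p)).
    move=> [[e [[g g'] gg]] /= p]; apply: val_inj => /=; congr (_, _).
    exact: val_inj.
  move=> [[[[e g] eg] g'] /= p]; apply: val_inj => /=; congr (_, _).
  exact: val_inj.
move=> [[e1 [[g1 k1] /= q1]] /= p1] [[e2 [[g2 k2] /= q2]] /= p2].
rewrite /comp_ole /= -!val_eqE /= !xpair_eqE /comp_ole /=.
by case: (k1 == k2); case: (g1 == g2); rewrite /= ?andbT ?andbF ?orbF.
Qed.

End CompositionIsomorphisms.

Lemma spankk V E k : @span V E k k = id_oedges (V k).
Proof. by elim: k V E => //= k IH V E; exact: (IH (fun n => V n.+1)). Qed.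

Lemma spanS V E k l : k <= l -> @span V E k l.+1 = span E k l \oe E l.
Proof.
elim: k l V E => //= k IH [//|l] V E kl.
exact: (IH l (fun n => V n.+1) (fun n => E n.+1) kl).
Qed.

Section Induced.
Variables (B C : bratteli) (f : premorphism B C).
Local Notation lev := (pm_level f).

Lemma span0_split k l : k <= l ->
  exists h : span (edges C) 0 k \oe span (edges C) k l -> span (edges C) 0 l,
  is_oiso h /\
  forall x : bpath C, exists2 q : span (edges C) 0 k \oe span (edges C) k l,
    (val q).1 = prefix x k & h q = prefix x l.
Proof.
move=> /subnK <-; elim: (l - k) => [|d [h [hi hx]]].
  rewrite add0n spankk /=.
  have P (e : span0 (edges C) k) : rng e == src (rng e : id_oedges (vertex C k)).
    by [].
  exists (fun p => (val p).1); split; last first.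
    by move=> x; exists (exist _ (prefix x k, rng (prefix x k)) (P _)).
  split.
  - exists (fun e => exist _ (e, rng e) (P e)) => // -[[e v] /= ev].
    by apply: val_inj => /=; rewrite (eqP ev).
  - by [].
  - by move=> [[e v] /= ev]; rewrite /comp_rng /= (eqP ev).
  - move=> [[e v] /= ev] [[e' v'] /= ev']; rewrite /comp_ole /= andNb /=.
    apply/idP/andP => [ee'|[]//]; split=> //.
    by rewrite -(eqP ev) -(eqP ev') (ole_rng ee').
rewrite addSn spanS ?leq_addl//.
have [a [ai ax]] := oiso_assoc (span (edges C) 0 k)
  (span (edges C) k (d + k)) (edges C (d + k)).
have [b [bi bx]] := oiso_compl (edges C (d + k)) hi.
exists (b \o a); split; first exact: is_oiso_comp.
move=> x; have [q qk qd] := hx x.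
have qx : rng q = src (x (d + k)).
  by have [_ _ hr _] := hi; rewrite -hr qd; exact: rng_prefix.
have [r rE] := @comp_edge_exists _ _ _ (span (edges C) k (d + k))
  (edges C (d + k)) (val q).2 (x (d + k)) qx.
have qr : rng (val q).1 = src r.
  by rewrite [src r]/= /comp_src rE; exact: (eqP (valP q)).
have [s sE] := comp_edge_exists qr.
exists s; first by rewrite sE.
apply: val_inj; rewrite val_prefixS /= bx.
have [a1 a2 a3] := ax s; rewrite a3 sE /= rE /=; congr (_, _).
rewrite -qd; congr h; apply: val_inj.
rewrite [LHS]surjective_pairing [RHS]surjective_pairing.
by rewrite a1 a2 sE /= rE.
Qed.

Lemma pm_edge0P (d d' : pm_edges f 0) : d = d'.
Proof. by apply: singleton_eq; exact: pm_singleton. Qed.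

Lemma pm_edge0_ex : exists d : pm_edges f 0, True.
Proof. by have /card_gt0P[d _] := pm_neq0 f 0; exists d. Qed.

Lemma start_edge n x : exists q : pm_edges f 0 \oe span (edges C) 0 (lev n),
  (val q).2 = prefix x (lev n).
Proof.
have [d _] := pm_edge0_ex.
have dx : rng d = src (prefix x (lev n)).
  by apply: singleton_eq; exact: vertex0_singleton.
by have [q qE] := comp_edge_exists dx; exists q; rewrite qE.
Qed.

Lemma start_edge_inj n (q q' : pm_edges f 0 \oe span (edges C) 0 (lev n)) :
  (val q).2 = (val q').2 -> q = q'.
Proof.
case: q q' => [[d s] p] [[d' s'] p'] /= ss; apply: val_inj => /=.
by rewrite ss (pm_edge0P d d').
Qed.

Definition level_iso n
    (h : pm_edges f 0 \oe span (edges C) 0 (lev n) ->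
         span (edges B) 0 n \oe pm_edges f n) : Prop := is_oiso h.

Lemma level_iso0 : exists h, @level_iso 0 h.
Proof.
have P (p : pm_edges f 0 \oe id_oedges (vertex C 0)) :
    rng (src (val p).1 : id_oedges (vertex B 0)) == src (val p).1.
  by [].
have P' (p : id_oedges (vertex B 0) \oe pm_edges f 0) :
    rng (val p).2 == src (rng (val p).2 : id_oedges (vertex C 0)).
  by [].
exists (fun p => exist _ (src (val p).1, (val p).1) (P p)); split.
- exists (fun p => exist _ ((val p).2, rng (val p).2) (P' p)).
    by move=> [[d v] /= dv]; apply: val_inj => /=; rewrite (eqP dv).
  by move=> [[v d] /= dv]; apply: val_inj => /=; rewrite (eqP dv).
- by [].
- by move=> [[d v] /= dv]; rewrite /comp_rng /= (eqP dv).
- move=> [[d v] /= dv] [[d' v'] /= dv']; rewrite /comp_ole /=.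
  have -> : d' = d by exact: pm_edge0P.
  by rewrite !eqxx ole_refl /= andbT andNb; apply/esym/eqP;
    rewrite -(eqP dv) -(eqP dv') (pm_edge0P d' d).
Qed.

Lemma level_isoS n h : @level_iso n h ->
  exists2 h', @level_iso n.+1 h' & forall x
      (q : pm_edges f 0 \oe span (edges C) 0 (lev n))
      (q' : pm_edges f 0 \oe span (edges C) 0 (lev n.+1)),
    (val q).2 = prefix x (lev n) -> (val q').2 = prefix x (lev n.+1) ->
    (val (val (h' q')).1).1 = (val (h q)).1.
Proof.
move=> hi.
have [c ci] := pm_commute f n.
have [c' cK c'K] : bijective c by case: ci.
have c'i := is_oiso_inv ci cK c'K.
have [s [si sx]] := span0_split (pm_le f n).
have [s' sK s'K] : bijective s by case: si.
have [k1 [k1i k1E]] := oiso_compr (pm_edges f 0) (is_oiso_inv si sK s'K).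
have [k2 [k2i k2E]] := oiso_assoc (pm_edges f 0) (span (edges C) 0 (lev n))
  (span (edges C) (lev n) (lev n.+1)).
have [k3 [k3i k3E]] := oiso_compl (span (edges C) (lev n) (lev n.+1)) hi.
have [k4 [k4i k4E]] := oiso_assoc (span (edges B) 0 n) (pm_edges f n)
  (span (edges C) (lev n) (lev n.+1)).
have [k4' k4K k4'K] : bijective k4 by case: k4i.
have [k5 [k5i k5E]] := oiso_compr (span (edges B) 0 n) c'i.
have [k6 [k6i k6E]] := oiso_assoc (span (edges B) 0 n) (edges B n)
  (pm_edges f n.+1).
exists (k6 \o (k5 \o (k4' \o (k3 \o (k2 \o k1))))).
  apply: is_oiso_comp k6i; apply: is_oiso_comp k5i.
  apply: is_oiso_comp (is_oiso_inv k4i k4K k4'K).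
  by apply: is_oiso_comp k3i; exact: is_oiso_comp k1i k2i.
move=> x q q' qx q'x /=.
have [-> _ _] := k6E (k5 (k4' (k3 (k2 (k1 q'))))).
rewrite k5E /=.
have [<- _ _] := k4E (k4' (k3 (k2 (k1 q')))).
rewrite k4'K k3E /=; congr ((val (h _)).1).
apply: start_edge_inj; rewrite qx.
have [_ -> _] := k2E (k1 q'); rewrite k1E /= q'x.
by have [t <- <-] := sx x; rewrite sK.
Qed.

Lemma level_iso_ex n : exists h, @level_iso n h.
Proof.
elim: n => [|n [h hi]]; first exact: level_iso0.
by have [h' ? _] := level_isoS hi; exists h'.
Qed.

Lemma pm_map_ex x : exists y, pm_map_graph f x y.
Proof.
pose h n := projT1 (cid (level_iso_ex n)).
have hi n : level_iso (h n) := projT2 (cid (level_iso_ex n)).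
pose q n := projT1 (cid (start_edge n x)).
have qE n : (val (q n)).2 = prefix x (lev n) := projT2 (cid (start_edge n x)).
pose p n : span0 (edges B) n := (val (h n (q n))).1.
have pS n : (val (p n.+1)).1 = p n.
  have [h' h'i h'x] := level_isoS (hi n).
  rewrite /p (is_oiso_unique (hi n.+1) h'i).
  exact: (h'x x (q n) (q n.+1) (qE n) (qE n.+1)).
pose y n : edges B n := (val (p n.+1)).2.
have yP n : rng (y n) = src (y n.+1).
  have -> : rng (y n) = rng (p n.+1) by [].
  by rewrite -pS; exact: (eqP (valP (p n.+2))).
have py n : p n = prefix (BPath yP) n.
  elim: n => [|n IH].
    exact: (@singleton_eq (vertex B 0) _ _ (vertex0_singleton B)).
  have inj (u v : span0 (edges B) n \oe edges B n) : val u = val v -> u = v.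
    exact: val_inj.
  by apply: inj; rewrite val_prefixS -IH -(pS n); exact: surjective_pairing.
by exists (BPath yP) => n _; exists (h n), (q n); split; [exact: hi|exact: qE|exact: py].
Qed.

Lemma pm_map_fun x y y' : pm_map_graph f x y -> pm_map_graph f x y' -> y = y'.
Proof.
move=> xy xy'; apply: bpath_eq => n.
have [h [q [hi qx hq]]] := xy n.+1 isT.
have [h' [q' [h'i q'x hq']]] := xy' n.+1 isT.
have qq' : q = q' by apply: start_edge_inj; rewrite qx q'x.
suff /prefix_eqP : prefix y n.+1 = prefix y' n.+1 by exact.
by rewrite -hq -hq' qq' (is_oiso_unique hi h'i).
Qed.

(* V([f]) *)
Definition pm_map x : bpath B := projT1 (cid (pm_map_ex x)).

Lemma pm_mapP x : pm_map_graph f x (pm_map x).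
Proof. exact: projT2 (cid (pm_map_ex x)). Qed.

End Induced.

Definition pointed_factor_maps (X Y : topologicalType) (phi : X -> X)
    (psi : Y -> Y) (x : X) (y : Y) :=
  {alpha : X -> Y | factor_map phi psi alpha /\ alpha x = y}.

(* Main.v *)
(** An ordered edge set is determined up to isomorphism by its words: the word
    of a vertex w lists, in order, the sources of the edges into w.  Composition
    of edge sets is substitution of words.

    Say that a map alpha from X_C to X_B reads the words u (w) in V_n^*, for w in
    W_l, if the first n edges of alpha z are a function of the first l edges of z
    and if, while the first l edges of z run through all paths to w in increasing
    order, the first n edges of alpha z run through all paths to the first letter
    of u (w), then through all paths to its second letter, and so on.  Readings
    compose by substitution, they are determined by alpha, and they determine the
    first n edges of alpha z.  The identity reads the words of E_{n,m}, and V([f])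
    reads the words of F_n; hence V([f]) commutes with the Vershik maps, and two
    premorphisms are equivalent iff they induce the same map.

    Conversely, let alpha be a factor map fixing x_max, hence also x_min.  By
    compactness, for every n and all large l the first n edges of alpha z depend
    only on the first l edges of z, and are minimal whenever those are.  So
    between two consecutive visits of z to minimal paths of length l, alpha z
    passes through complete blocks of paths of length n, that is, alpha reads
    words at (n, l).  These words are the edge sets of a premorphism inducing
    alpha. *)
Require Import Defs.
From mathcomp Require Import all_boot.
From mathcomp Require Import boolp classical_sets functions topology cantor.
(* [prefix] means the prefix of a path, not [seq.prefix]. *)
Import Defs.

Set Implicit Arguments.
Unset Strict Implicit.
Unset Printing Implicit Defensive.

Local Open Scope classical_set_scope.
Local Open Scope nat_scope.

(** * Words of ordered edge sets *)

Section Fibres.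
Context {S T : finType}.
Implicit Types F G : oedges S T.

Definition fibre F (t : T) : seq F :=
  sort (@ole S T F) [seq e <- enum F | rng e == t].

Definition word F (t : T) : seq S := [seq src e | e <- fibre F t].

Lemma mem_fibre F t e : (e \in fibre F t) = (rng e == t).
Proof. by rewrite mem_sort mem_filter mem_enum andbT. Qed.

Lemma fibre_uniq F t : uniq (fibre F t).
Proof. by rewrite sort_uniq filter_uniq// enum_uniq. Qed.

Lemma fibre_sorted F t : sorted (@ole S T F) (fibre F t).
Proof.
(* [ole] is total only among edges of equal range, so sorting is correct only relative to the
   fibre. *)
apply: (@sort_sorted_in _ [pred e | rng e == t]) => [e e'|].
  by rewrite !inE ole_comparable => /eqP -> /eqP ->.
by apply/allP => e; rewrite mem_filter => /andP[].
Qed.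

Lemma fibreE F t s : uniq s -> sorted (@ole S T F) s ->
  (forall e, (e \in s) = (rng e == t)) -> s = fibre F t.
Proof.
move=> us ss ms; apply: (sorted_eq (@ole_trans S T F) (@ole_anti S T F)) => //.
  exact: fibre_sorted.
by apply: uniq_perm => // [|e]; rewrite ?fibre_uniq// mem_fibre ms.
Qed.

Lemma ole_index F t (e e' : F) : rng e = t -> rng e' = t ->
  ole e e' = (index e (fibre F t) <= index e' (fibre F t)).
Proof.
move=> /eqP; rewrite -mem_fibre => et /eqP; rewrite -mem_fibre => e't.
apply/idP/idP => [ee'|].
  rewrite leqNgt; apply/negP => lt.
  have := sorted_ltn_index (@ole_trans S T F) (fibre_sorted F t) _ _ e't et lt.
  move=> e'e; have eE : e = e' by apply/ole_anti; rewrite ee'.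
  by rewrite eE ltnn in lt.
exact: (sorted_leq_index (@ole_trans S T F) (@ole_refl S T F)
  (fibre_sorted F t) _ _ et e't).
Qed.

Lemma is_oiso_fibre F G (h : F -> G) t : is_oiso h ->
  [seq h e | e <- fibre F t] = fibre G t.
Proof.
move=> [[k hK kK] hs hr ho]; apply: fibreE.
- by rewrite (map_inj_uniq (can_inj hK)) fibre_uniq.
- rewrite sorted_map; apply: sub_sorted (fibre_sorted F t) => e e' /=.
  by rewrite ho.
- move=> g; rewrite -{1}[g]kK (mem_map (can_inj hK)) mem_fibre.
  by rewrite -hr kK.
Qed.

(** An isomorphism carries fibres to fibres in order. Conversely, when the words agree, edges with
    equal range and equal position in their fibres correspond; this is the relation [P], and choice
    in both directions gives the bijection and its inverse. *)
Lemma oisoP F G : oiso F G <-> forall t, word F t = word G t.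
Proof.
split=> [[h hi] t|FG].
  have [_ hs _ _] := hi.
  by rewrite /word -(is_oiso_fibre t hi) -map_comp; apply: eq_map => e /=.
pose P (F G : oedges S T) (e : F) (g : G) := rng g = rng e /\
  index g (fibre G (rng g)) = index e (fibre F (rng e)).
have P_ex (F1 G1 : oedges S T) : (forall t, word F1 t = word G1 t) ->
    forall e : F1, exists g : G1, P F1 G1 e g.
  move=> FG1 e; set i := index e (fibre F1 (rng e)).
  have ltiF : i < size (fibre F1 (rng e)) by rewrite index_mem mem_fibre.
  have ltiG : i < size (fibre G1 (rng e)).
    by have /(congr1 size) := FG1 (rng e); rewrite !size_map => <-.
  case E : (fibre G1 (rng e)) => [|g0 s]; first by rewrite E in ltiG.
  exists (nth g0 (fibre G1 (rng e)) i).
  have /eqP re : rng (nth g0 (fibre G1 (rng e)) i) == rng e.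
    by rewrite -mem_fibre mem_nth.
  by split=> //; rewrite re index_uniq// fibre_uniq.
have [h hP] := choice (P_ex F G FG).
have [k kP] := choice (P_ex G F (fun t => esym (FG t))).
have inj (F1 : oedges S T) (e e' : F1) : rng e = rng e' ->
    index e (fibre F1 (rng e)) = index e' (fibre F1 (rng e')) -> e = e'.
  by move=> ee'; rewrite -ee'; apply: (index_inj e); rewrite mem_fibre ?ee'.
exists h; split.
- exists k => e; apply: inj.
  + by rewrite (kP _).1 (hP _).1.
  + by rewrite (kP _).2 (hP _).2.
  + by rewrite (hP _).1 (kP _).1.
  + by rewrite (hP _).2 (kP _).2.
- move=> e; have [re ie] := hP e.
  have src_nth (F1 : oedges S T) (e1 : F1) s :
      src e1 = nth s (word F1 (rng e1)) (index e1 (fibre F1 (rng e1))).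
    by rewrite (nth_map e1) ?nth_index ?index_mem ?mem_fibre.
  by rewrite (src_nth _ (h e) (src e)) ie re -FG -src_nth.
- by move=> e; exact: (hP e).1.
- move=> e e'; have [re ie] := hP e; have [re' ie'] := hP e'.
  have [ee'|ne] := eqVneq (rng e) (rng e').
    rewrite (ole_index (t := rng (h e)))// ?ie ?re' ?re//.
    by rewrite [RHS](ole_index (t := rng e))// -ie ee' -ie' re'.
  have nole (F1 : oedges S T) (e1 e2 : F1) : rng e1 != rng e2 ->
      ole e1 e2 = false.
    by move=> ne1; apply/negP => /ole_rng /eqP; rewrite (negbTE ne1).
  by rewrite !nole// re re'.
Qed.

(** When [F] consists of the paths from the top vertex, these are the prefixes met by an orbit that
    climbs the towers over the letters of [u] in turn. *)
Definition spread F (u : seq T) : seq F := flatten [seq fibre F t | t <- u].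

Lemma spread_flatten F (us : seq (seq T)) :
  spread F (flatten us) = flatten [seq spread F u | u <- us].
Proof. by elim: us => //= u us <-; rewrite /spread map_cat flatten_cat. Qed.

Lemma rng_spread F u e : e \in spread F u -> rng e \in u.
Proof. by move=> /flattenP[_ /mapP[t tu ->]]; rewrite mem_fibre => /eqP ->. Qed.

Lemma fibre_neq0 F t : (exists e : F, rng e = t) -> fibre F t <> [::].
Proof. by move=> [e /eqP]; rewrite -mem_fibre => + E; rewrite E. Qed.

(** The range of the first edge gives back the first letter, whose whole fibre can then be
    cancelled. *)
Lemma spread_inj F : (forall t, exists e : F, rng e = t) -> injective (spread F).
Proof.
move=> Fsurj; have cons_neq0 t u : spread F (t :: u) <> [::].
  rewrite /spread /=; case E : fibre => //; have := fibre_neq0 (Fsurj t).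
  by rewrite E.
elim=> [|t u IH] [|t' u'] //; [by move=> /esym/cons_neq0|by move=> /cons_neq0|].
move=> E; have tt' : t = t'.
  have := fibre_neq0 (Fsurj t); have := fibre_neq0 (Fsurj t').
  have mt e : e \in fibre F t -> rng e = t by rewrite mem_fibre => /eqP.
  have mt' e : e \in fibre F t' -> rng e = t' by rewrite mem_fibre => /eqP.
  move: E mt mt'; rewrite /spread /=.
  case: (fibre F t) => [|a s]//; case: (fibre F t') => [|a' s']//=.
  move=> [<- _] mt mt' _ _.
  by rewrite -(mt a) ?(mt' a)// mem_head.
move: E; rewrite /spread /= tt' => /eqP; rewrite eqseq_cat// eqxx /= => /eqP.
by move=> /IH ->.
Qed.

Lemma fibre_successor F t i e0 : i.+1 < size (fibre F t) ->
  successor_edge (nth e0 (fibre F t) i) (nth e0 (fibre F t) i.+1).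
Proof.
move=> lti; have lti' := ltnW lti.
have rt j : j < size (fibre F t) -> rng (nth e0 (fibre F t) j) = t.
  by move=> ltj; apply/eqP; rewrite -mem_fibre mem_nth.
have ix j : j < size (fibre F t) -> index (nth e0 (fibre F t) j) (fibre F t) = j.
  by move=> ltj; rewrite index_uniq// fibre_uniq.
split.
- by rewrite (ole_index (t := t)) ?rt// !ix.
- by rewrite nth_uniq ?fibre_uniq// gtn_eqF.
- move=> g eg ge; have rg : rng g = t by rewrite -(ole_rng eg) rt.
  move: eg; rewrite !(ole_index (t := t)) ?rt// !ix//.
  rewrite leq_eqVlt => /predU1P[iE|//]; case/eqP: ge.
  by rewrite iE nth_index// mem_fibre rg.
Qed.

Lemma fibreP F t : (exists e : F, rng e = t) -> exists a s,
  [/\ fibre F t = a :: s, minimal_edge a,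
      path (fun e f => `[< successor_edge e f >]) a s
    & maximal_edge (last a s)].
Proof.
move=> /fibre_neq0; case E : fibre => [//|a s] _; exists a, s.
have ar : rng a = t by apply/eqP; rewrite -mem_fibre E mem_head.
have lr : rng (last a s) = t by apply/eqP; rewrite -mem_fibre E mem_last.
have mfib e : rng e = t -> e \in fibre F t by move=> /eqP; rewrite mem_fibre.
have pick (e e' : F) : ole e e' -> ole e' e -> e = e'.
  by move=> le ge; apply/ole_anti; rewrite le.
split=> //.
- move=> e ea; have re := ole_rng ea; apply: pick => //.
  rewrite (ole_index (t := t)) ?re//.
  by rewrite E /= eqxx.
- apply/(pathP a) => i lti; apply/asboolP.
  have := @fibre_successor F t i a; rewrite E /= ltnS => /(_ lti).
  by [].
- move=> e le; have re := ole_rng le; apply: pick => //.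
  have ert : rng e = t by rewrite -re.
  rewrite (ole_index (t := t))// (_ : index (last a s) _ = size s).
    by rewrite -ltnS -[(size s).+1]/(size (a :: s)) -E index_mem mfib.
  have := fibre_uniq F t; rewrite E => /index_uniq => ui.
  by rewrite -[last a s](nth_last a (a :: s)) ui.
Qed.

Lemma maximal_edge_inj F (e f : F) :
  maximal_edge e -> maximal_edge f -> rng e = rng f -> e = f.
Proof.
by move=> em fm /eqP; rewrite -ole_comparable => /orP[/em //|/fm //].
Qed.

Lemma successor_edge_nmax F (e f : F) : successor_edge e f -> ~ maximal_edge e.
Proof. by move=> [ef /eqP nf _] /(_ f ef). Qed.

(* The effect of the Vershik map on the initial segments of a path: the vertex
   reached by [f] is unspecified when [e] is maximal. *)
Definition cyclic_successor F (e f : F) :=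
  maximal_edge e /\ minimal_edge f \/ successor_edge e f.

(** What a concatenation of complete fibres retains once the boundaries between them are forgotten;
    it suffices to recover the dynamics from a reading. *)
Definition sweep F (s : seq F) := exists a s',
  [/\ s = a :: s', minimal_edge a,
      path (fun e f => `[< cyclic_successor e f >]) a s'
    & maximal_edge (last a s')].

Lemma sweep_cat F (s s' : seq F) : sweep s -> sweep s' -> sweep (s ++ s').
Proof.
move=> [a [t [-> am ta tm]]] [b [t' [-> bm tb tm']]].
exists a, (t ++ b :: t'); split=> //; last by rewrite last_cat.
by rewrite cat_path /= ta tb andbT; apply/asboolP; left.
Qed.

Lemma sweep_fibre F t : (exists e : F, rng e = t) -> sweep (fibre F t).
Proof.
move=> /fibreP[a [s [E am p lm]]]; exists a, s; split=> //.
by apply: sub_path p => e f /asboolP ef; apply/asboolP; right.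
Qed.

Lemma sweep_spread F u : (forall t, exists e : F, rng e = t) -> u <> [::] ->
  sweep (spread F u).
Proof.
move=> Fsurj; elim: u => [//|t [_ _|t' u IH _]].
  by rewrite /spread /= cats0; exact: sweep_fibre.
by apply: sweep_cat; [exact: sweep_fibre|apply: IH].
Qed.

End Fibres.

Section FibresComposition.
Context {S T U : finType} (F : oedges S T) (G : oedges T U).

(** The order [comp_ole] extended to all pairs, matching or not, so that lists of pairs can be
    compared after applying [val]. *)
Definition lexo (p q : F * G) :=
  (p.2 != q.2) && ole p.2 q.2 || (p.2 == q.2) && ole p.1 q.1.

Lemma lexo_trans : transitive lexo.
Proof.
move=> [e' g'] [e g] [e'' g'']; rewrite /lexo /=.
have [->|gg'] := eqVneq g g'; have [<-|gg''] := eqVneq g' g'';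
  rewrite /= ?eqxx ?orbF //=.
- exact: ole_trans.
- by rewrite gg' => ->.
have [gg|_] := eqVneq g g'' => /=; last by rewrite orbF; exact: ole_trans.
rewrite -gg in gg'' *; move=> a b.
by have /eqP := ole_anti (introT andP (conj a b)); rewrite (negbTE gg').
Qed.

Lemma lexo_anti : antisymmetric lexo.
Proof.
move=> [e g] [e' g']; rewrite /lexo /=.
have [->|gg] := eqVneq g g'; rewrite /= ?orbF; first by move=> /ole_anti ->.
by move=> /ole_anti /eqP; rewrite (negbTE gg).
Qed.

(** Second components are compared first, so the fibre splits into consecutive blocks, one for each
    [g]. Both lists are sorted for [lexo] and have the same elements, hence coincide. *)
Lemma fibre_comp u : [seq val p | p <- fibre (F \oe G) u] =
  flatten [seq [seq (e, g) | e <- fibre F (src g)] | g <- fibre G u].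
Proof.
apply: (sorted_eq lexo_trans lexo_anti).
- by rewrite sorted_map; exact: (fibre_sorted (F \oe G) u).
- rewrite (sorted_pairwise lexo_trans).
  have := fibre_sorted G u; rewrite (sorted_pairwise (@ole_trans _ _ G)).
  have := fibre_uniq G u; elim: (fibre G u) => //= g s IH /andP[gs us].
  move=> /andP[/allP gle ps]; rewrite pairwise_cat IH// andbT.
  apply/andP; split.
    apply/allrelP => p q /mapP[e _ ->] /flattenP[_ /mapP[g' g's ->]].
    move=> /mapP[e' _ ->]; rewrite /lexo /= gle// andbT.
    by have -> : g != g' by apply: contraNneq gs => ->.
  rewrite pairwise_map -(sorted_pairwise _); last first.
    by move=> e e' e'' /=; rewrite /lexo /= eqxx /=; exact: ole_trans.
  apply: sub_sorted (fibre_sorted F (src g)) => e e' ee'.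
  by rewrite /= /lexo /= eqxx.
- apply: uniq_perm; first rewrite (map_inj_uniq val_inj).
    exact: (fibre_uniq (F \oe G) u).
    apply: (@allpairs_uniq_dep _ (fun=> F) _ (fun g e => (e, g)) (fibre G u)
      (fun g => fibre F (src g))); first exact: fibre_uniq.
      by move=> g _; exact: fibre_uniq.
    by move=> [g e] [g' e'] _ _ /= [-> ->].
  have mem_comp (p : F \oe G) :
      (p \in fibre (F \oe G) u) = (rng (val p).2 == u).
    exact: mem_fibre.
  move=> [e g]; apply/mapP/flattenP => [[p + pE]|[_ /mapP[g' g'u ->]]].
    rewrite mem_comp -pE /= => ru.
    exists [seq (e, g) | e <- fibre F (src g)].
      by apply: map_f; rewrite mem_fibre.
    apply/mapP; exists e => //; rewrite mem_fibre.
    by have := valP p; rewrite -pE.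
  move=> /mapP[e' + [-> ->]]; rewrite mem_fibre => /eqP e'g'.
  have [p pE] := comp_edge_exists e'g'.
  by exists p => //; rewrite mem_comp pE /= -mem_fibre.
Qed.

Lemma fibre_comp1 u :
  [seq (val p).1 | p <- fibre (F \oe G) u] = spread F (word G u).
Proof.
rewrite (map_comp fst) fibre_comp map_flatten -map_comp /spread -map_comp.
congr flatten; apply: eq_map => g /=.
by rewrite -map_comp -[RHS]map_id.
Qed.

Lemma word_comp u : word (F \oe G) u = flatten [seq word F t | t <- word G u].
Proof.
transitivity [seq src e | e <- [seq (val p).1 | p <- fibre (F \oe G) u]].
  by rewrite -map_comp.
by rewrite fibre_comp1 map_flatten -map_comp.
Qed.

Hypothesis Fsurj : forall t, exists e : F, rng e = t.

Lemma maximal_edge_comp (p : F \oe G) :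
  maximal_edge p <-> maximal_edge (val p).1 /\ maximal_edge (val p).2.
Proof.
case: p => [[e g] /= eg]; split=> [pm|[em gm]].
  split=> [e' ee'|g' gg'].
    have e'g : rng e' = src g by rewrite -(ole_rng ee'); exact/eqP.
    have [q qE] := comp_edge_exists e'g.
    have /(congr1 val) : q = exist _ (e, g) eg.
      by apply: pm; rewrite /ole /= /comp_ole qE /= eqxx ee'.
    by rewrite qE => -[].
  (* [Fsurj] completes [g'] to a pair, which would exceed [(e, g)] if [g'] differed from [g]. *)
  have [e' e'g'] := Fsurj (src g').
  have [q qE] := comp_edge_exists e'g'.
  have [//|ne] := eqVneq g' g.
  have /(congr1 val) : q = exist _ (e, g) eg.
    by apply: pm; rewrite /ole /= /comp_ole qE /= eq_sym ne gg'.
  by rewrite qE => -[].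
move=> [[e' g'] /= q]; rewrite /ole /= /comp_ole /=.
move=> /orP[/andP[/eqP ne /gm /esym//]|/andP[/eqP gg' /em ee']].
by apply: val_inj; rewrite /= ee' gg'.
Qed.

Lemma minimal_edge_comp (p : F \oe G) :
  minimal_edge p <-> minimal_edge (val p).1 /\ minimal_edge (val p).2.
Proof.
case: p => [[e g] /= eg]; split=> [pm|[em gm]].
  split=> [e' ee'|g' gg'].
    have e'g : rng e' = src g by rewrite (ole_rng ee'); exact/eqP.
    have [q qE] := comp_edge_exists e'g.
    have /(congr1 val) : q = exist _ (e, g) eg.
      by apply: pm; rewrite /ole /= /comp_ole qE /= eqxx ee'.
    by rewrite qE => -[].
  have [e' e'g'] := Fsurj (src g').
  have [q qE] := comp_edge_exists e'g'.
  have [//|ne] := eqVneq g' g.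
  have /(congr1 val) : q = exist _ (e, g) eg.
    by apply: pm; rewrite /ole /= /comp_ole qE /= ne gg'.
  by rewrite qE => -[].
move=> [[e' g'] /= q]; rewrite /ole /= /comp_ole /=.
move=> /orP[/andP[/eqP ne /gm //]|/andP[/eqP gg' /em ee']].
by apply: val_inj; rewrite /= ee' gg'.
Qed.

Lemma successor_edge_compl (p q : F \oe G) : (val p).2 = (val q).2 ->
  successor_edge (val p).1 (val q).1 -> successor_edge p q.
Proof.
case: p q => [[e g] /= eg] [[e' g'] /= eg'] gg'; subst g'.
move=> [ee' ne' e'min]; split.
- by rewrite /ole /= /comp_ole /= eqxx ee'.
- by rewrite -val_eqE /= xpair_eqE negb_and ne'.
move=> [[e1 g1] /= eg1]; rewrite -val_eqE /ole /= /comp_ole /= xpair_eqE.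
have [<-|] := eqVneq g g1; last by rewrite orbF.
by rewrite /= andbT; exact: e'min.
Qed.

Lemma successor_edge_compr (p q : F \oe G) :
  maximal_edge (val p).1 -> minimal_edge (val q).1 ->
  successor_edge (val p).2 (val q).2 -> successor_edge p q.
Proof.
case: p q => [[e g] /= eg] [[e' g'] /= eg'] em e'm [gg' ng' g'min]; split.
- by rewrite /ole /= /comp_ole /= eq_sym ng' gg'.
- by rewrite -val_eqE /= xpair_eqE negb_and ng' orbT.
move=> [[e1 g1] /= eg1]; rewrite -val_eqE /ole /= /comp_ole /= xpair_eqE.
have [gg1|ne] := eqVneq g g1.
  by rewrite /= andbT => /em -> /eqP.
rewrite /= orbF => gg1 _; have g'g1 : ole g' g1 by rewrite g'min// eq_sym.
have [g'E|_] := eqVneq g' g1; last by rewrite /= g'g1.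
have : rng e' == rng e1 by rewrite (eqP eg') (eqP eg1) /= g'E.
by rewrite /= -ole_comparable => /orP[//|/e'm ->]; exact: ole_refl.
Qed.

End FibresComposition.

(** * Initial segments of paths and the Vershik map *)

(** The paths from the top vertex to a given vertex of level [n], in increasing order: the floors of
    the Kakutani-Rokhlin tower over that vertex, which the Vershik map climbs one by one. *)
Local Notation tower B n := (fibre (span0 (edges B) n)).

Section Prefixes.
Variable B : bratteli.
Implicit Types x y : bpath B.

Lemma span0_rng_surj n v : exists p : span0 (edges B) n, rng p = v.
Proof.
elim: n v => [v|n IH v]; first by exists (v : span0 (edges B) 0).
have [e ev] := rng_surj v; have [p pe] := IH (src e).
by have [q qE] := comp_edge_exists pe; exists q; rewrite /rng /= /comp_rng qE.
Qed.

Lemma edge_extends n (e : edges B n) : exists z : forall i, edges B i,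
  z n = e /\ forall i, n <= i -> rng (z i) = src (z i.+1).
Proof.
have [d _] : exists d : forall i, edges B i, True.
  have {}d i : exists e : edges B i, True.
    by have /card_gt0P[e' _] := edges_neq0 B i; exists e'.
  by exists (fun i => projT1 (cid (d i))).
have next_ex i (e' : edges B i) : exists e'' : edges B i.+1, src e'' = rng e'.
    exact: src_surj.
pose next i (e' : edges B i) : edges B i.+1 := projT1 (cid (next_ex i e')).
have nextP i (e' : edges B i) : src (next i e') = rng e'.
  exact: (projT2 (cid (next_ex i e'))).
pose w : forall i, edges B i := @dfwith nat (fun i => edges B i : Type) d n e.
(* Up to index [n] this copies [w], whose value at [n] is [e]; beyond [n] each edge is chosen to
   continue the previous one. Below [n] the edges need not match. *)
pose z := fix z i : edges B i :=
  if i is j.+1 return edges B i then if j < n then w j.+1 else next j (z j)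
  else w 0.
exists z; split=> [|i ni]; last by rewrite /= ltnNge ni /= nextP.
have -> : z n = w n by rewrite /z; case: (n) => //= m; rewrite ltnSn.
exact: dfwith_in.
Qed.

(** By induction on [n]: the last edge of [p] overwrites [z] at the last position of the prefix, and
    the shorter path is glued to the modified tail. *)
Lemma prefix_tail n (p : span0 (edges B) n) (z : forall i, edges B i) :
    (forall i, n <= i -> rng (z i) = src (z i.+1)) -> rng p = src (z n) ->
  exists x, prefix x n = p /\ forall i, n <= i -> x i = z i.
Proof.
elim: n p z => [p z zP _|n IH [[p e] /= pe] z zP ez].
  exists (BPath (fun i => zP i (leq0n i))); split=> //.
  by apply: (@singleton_eq (vertex B 0)); exact: vertex0_singleton.
pose z' : forall i, edges B i := @dfwith nat (fun i => edges B i : Type) z n e.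
have z'n : z' n = e by exact: dfwith_in.
have z'N i : n != i -> z' i = z i by exact: dfwith_out.
have z'P i : n <= i -> rng (z' i) = src (z' i.+1).
  rewrite leq_eqVlt => /predU1P[<-|ni].
    by rewrite z'n z'N ?ltn_eqF.
  by rewrite !z'N ?ltn_eqF// ?zP// ltnW.
have [|x [xp xz]] := IH p z' z'P; first by rewrite z'n; exact/eqP.
exists x; split=> [|i ni]; last by rewrite xz ?(ltnW ni)// z'N ?ltn_eqF.
by apply: val_inj; rewrite val_prefixS xp xz// z'n.
Qed.

Lemma prefix_surj n (p : span0 (edges B) n) : exists x, prefix x n = p.
Proof.
have [e ep] := src_surj (rng p); have [z [ze zP]] := edge_extends e.
by have [|x [xp _]] := prefix_tail (p := p) zP; [rewrite ze ep|exists x].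
Qed.

Lemma prefix_le n m x y : n <= m -> prefix x m = prefix y m ->
  prefix x n = prefix y n.
Proof.
move=> nm /prefix_eqP xy; apply/prefix_eqP => i ni.
by apply: xy; exact: leq_trans nm.
Qed.

Lemma prefix_inj x y : (forall n, exists2 m, n <= m & prefix x m = prefix y m) ->
  x = y.
Proof.
move=> xy; apply: bpath_eq => n; have [m nm /prefix_eqP] := xy n.+1.
exact.
Qed.

Lemma extremal_prefix0 (p : span0 (edges B) 0) : maximal_edge p /\ minimal_edge p.
Proof.
by split=> q _; apply: (@singleton_eq (vertex B 0)); exact: vertex0_singleton.
Qed.

Lemma maximal_prefix x n :
  maximal_edge (prefix x n) <-> forall i, i < n -> maximal_edge (x i).
Proof.
elim: n => [|n IH]; first by split=> // _; exact: (extremal_prefix0 _).1.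
have := maximal_edge_comp (@span0_rng_surj n) (prefix x n.+1).
rewrite val_prefixS /= IH => E; split=> [/E[xm xn] i|xm].
  by rewrite ltnS leq_eqVlt => /predU1P[->//|]; exact: xm.
by apply/E; split=> [i ni|]; apply: xm => //; exact: ltnW.
Qed.

Lemma minimal_prefix x n :
  minimal_edge (prefix x n) <-> forall i, i < n -> minimal_edge (x i).
Proof.
elim: n => [|n IH]; first by split=> // _; exact: (extremal_prefix0 _).2.
have := minimal_edge_comp (@span0_rng_surj n) (prefix x n.+1).
rewrite val_prefixS /= IH => E; split=> [/E[xm xn] i|xm].
  by rewrite ltnS leq_eqVlt => /predU1P[->//|]; exact: xm.
by apply/E; split=> [i ni|]; apply: xm => //; exact: ltnW.
Qed.

Lemma max_pathP x : max_path x <-> forall n, maximal_edge (prefix x n).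
Proof.
split=> [xm n|xm n]; first by apply/maximal_prefix => i _; exact: xm.
by have /maximal_prefix := xm n.+1; exact.
Qed.

Lemma min_pathP x : min_path x <-> forall n, minimal_edge (prefix x n).
Proof.
split=> [xm n|xm n]; first by apply/minimal_prefix => i _; exact: xm.
by have /minimal_prefix := xm n.+1; exact.
Qed.

Lemma nbhs_prefix x n : nbhs x [set y | prefix y n = prefix x n].
Proof.
rewrite nbhsE; exists (cylinder (prefix x n)) => //; split=> //.
exists [set cylinder (prefix x n)]; last by rewrite bigcup_set1.
by move=> _ ->; exists n, (prefix x n).
Qed.

Lemma nbhs_bpathP x (A : set (bpath B)) :
  nbhs x A -> exists n, forall y, prefix y n = prefix x n -> A y.
Proof.
rewrite nbhsE => -[U [[D Dcyl <-] [U0 DU0 U0x]] DA].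
have [n [p U0E]] := Dcyl _ DU0; exists n => y yx; apply: DA.
by exists U0 => //; move: U0x; rewrite U0E /cylinder /= yx.
Qed.

Lemma bpath_hausdorff : hausdorff_space (bpath B).
Proof.
move=> x y xy; apply: prefix_inj => n; exists n => //.
by have [z [<- <-]] := xy _ _ (nbhs_prefix x n) (nbhs_prefix y n).
Qed.

End Prefixes.

Section VershikMap.
Variable B : proper_bratteli.
Implicit Types x y : bpath B.

(** Let [k] be the first index at which [x] is not maximal. Up to length [k] a maximal prefix
    becomes a minimal one; at length [k.+1] the last edge moves to its successor; afterwards equal
    edges are appended, which preserves successors. *)
Lemma cyclic_successor_vershik x n :
  cyclic_successor (prefix x n) (prefix (vershik x) n).
Proof.
have [[xm ym]|[k [kmax _ ksucc kmin ktail]]] := vershikP x.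
  by left; split; [apply/maximal_prefix|apply/minimal_prefix] => i _.
have extr m : m <= k ->
    maximal_edge (prefix x m) /\ minimal_edge (prefix (vershik x) m).
  move=> mk; split; [apply/maximal_prefix|apply/minimal_prefix] => i im.
    by apply: kmax; exact: leq_trans mk.
  by apply: kmin; exact: leq_trans mk.
case: (leqP n k) => [/extr|]; first by left.
elim: n => // n IH; rewrite ltnS leq_eqVlt => /predU1P[<-|kn]; right.
  have [xm ym] := extr k (leqnn k).
  by apply: successor_edge_compr; rewrite !val_prefixS.
have [[/maximal_prefix /(_ k kn) xm _]|xS] := IH kn.
  by have := successor_edge_nmax ksucc.
by apply: successor_edge_compl; rewrite !val_prefixS//= ktail.
Qed.

(** If [x] is maximal, [y] must be the unique minimal path. Otherwise all long enough prefixes of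
    [x] are not maximal, and such prefixes have only one cyclic successor. *)
Lemma vershik_unique x y :
  (forall n, cyclic_successor (prefix x n) (prefix y n)) -> y = vershik x.
Proof.
move=> xy; have xv := cyclic_successor_vershik x.
have [/max_pathP xm|/max_pathP/existsNP[k xk]] := pselect (max_path x).
  have [z [_ zu]] := min_path_unique B.
  have all_min z' : (forall n, cyclic_successor (prefix x n) (prefix z' n)) ->
      min_path z'.
    move=> xz'; apply/min_pathP => n; have [[_ //]|/successor_edge_nmax] := xz' n.
    by have := xm n.
  by rewrite -(zu _ (all_min _ xy)) (zu _ (all_min _ xv)).
apply: prefix_inj => n; exists (maxn n k); first exact: leq_maxl.
have nxm : ~ maximal_edge (prefix x (maxn n k)).
  move=> /maximal_prefix xm; apply: xk; apply/maximal_prefix => i ik.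
  by apply: xm; rewrite leq_max ik orbT.
have [[//]|] := xy (maxn n k); have [[//]|] := xv (maxn n k).
by move=> s s'; exact: successor_edge_inj s' s.
Qed.

Lemma maximal_cyclic_successor S T (F : oedges S T) (e f : F) :
  maximal_edge e -> cyclic_successor e f -> minimal_edge f.
Proof. by move=> em [[]//|/successor_edge_nmax]. Qed.

Definition trace n y N := [seq prefix z n | z <- traject (@vershik B) y N].

Lemma traceD n y N M :
  trace n y (N + M) = trace n y N ++ trace n (iter N (@vershik B) y) M.
Proof. by rewrite /trace trajectD map_cat. Qed.

(** A prefix that has a successor is not maximal, so the Vershik map can only move it to that
    successor. *)
Lemma trace_successors n y a s : prefix y n = a ->
  path (fun e f => `[< successor_edge e f >]) a s ->
  trace n y (size s).+1 = a :: s.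
Proof.
elim: s y a => [y a <- //|b s IH y a ya /= /andP[/asboolP ab p]].
have yb : prefix (vershik y) n = b.
  have := cyclic_successor_vershik y n; rewrite ya.
  move=> [[/(successor_edge_nmax ab) //]|ay]; exact: successor_edge_inj ay ab.
by rewrite -(IH _ _ yb p) /trace /= ya.
Qed.

Lemma trace_tower n y : minimal_edge (prefix y n) ->
  trace n y (size (tower B n (rng (prefix y n)))) = tower B n (rng (prefix y n)).
Proof.
move=> ym; set v := rng _.
have [a [s [E am p _]]] := fibreP (span0_rng_surj v).
have ar : rng a = v by apply/eqP; rewrite -mem_fibre E mem_head.
by rewrite E /= (trace_successors _ p)//; exact: minimal_edge_inj.
Qed.

Lemma prefix_iter_tower n y i a : minimal_edge (prefix y n) ->
  i < size (tower B n (rng (prefix y n))) ->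
  prefix (iter i (@vershik B) y) n = nth a (tower B n (rng (prefix y n))) i.
Proof.
by move=> /trace_tower <-; rewrite !size_map size_traject => iH;
  rewrite (nth_map y) ?size_traject// nth_traject.
Qed.

Lemma minimal_iter_tower n y : minimal_edge (prefix y n) ->
  let H := size (tower B n (rng (prefix y n))) in
  minimal_edge (prefix (iter H (@vershik B) y) n).
Proof.
move=> ym; have := @prefix_iter_tower n y.
have [a [s [-> _ _ lm]]] := fibreP (span0_rng_surj (rng (prefix y n))).
move=> /(_ (size s) a ym (ltnSn _)) ys /=.
have := cyclic_successor_vershik (iter (size s) (@vershik B) y) n.
by apply: maximal_cyclic_successor; rewrite ys -(last_nth a).
Qed.

(** By strong induction on [N]: the orbit first climbs the whole tower of its starting point, and
    then stands at a minimal prefix again. *)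
Lemma trace_spread n y N :
  minimal_edge (prefix y n) -> minimal_edge (prefix (iter N (@vershik B) y) n) ->
  exists u, trace n y N = spread (span0 (edges B) n) u.
Proof.
have [M] := ubnP N; elim: M N y => // M IH [|N] y NM ym yNm; first by exists [::].
have yH := trace_tower ym; have yHm := minimal_iter_tower ym.
have nthH i a := @prefix_iter_tower n y i a ym.
set v := rng _ in yH yHm nthH.
have [a [s [E am _ _]]] := fibreP (span0_rng_surj v).
have HE : size (tower B n v) = (size s).+1 by rewrite E.
(* The orbit cannot stop inside the first tower: its last prefix is minimal, but only floor 0 of a
   tower is. *)
have [HN|NH] := leqP (size (tower B n v)) N.+1; last first.
  have rN : rng (nth a (tower B n v) N.+1) = v.
    by apply/eqP; rewrite -mem_fibre mem_nth.
  have ar : rng a = v by apply/eqP; rewrite -mem_fibre E mem_head.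
  rewrite (nthH _ a)// in yNm.
  have := minimal_edge_inj yNm am; rewrite rN ar => /(_ erefl) /eqP.
  have {2}-> : a = nth a (tower B n v) 0 by rewrite E.
  by rewrite nth_uniq ?fibre_uniq// HE.
have [||u uE] := IH (N.+1 - size (tower B n v)) _ _ yHm.
- by rewrite HE subSS (leq_ltn_trans (leq_subr _ _)).
- by rewrite -iterD subnK.
by exists (v :: u); rewrite -(subnKC HN) traceD yH uE.
Qed.

Lemma vershik_max_path y : max_path y -> min_path (vershik y).
Proof.
move=> /max_pathP ym; apply/min_pathP => n.
exact: maximal_cyclic_successor (ym n) (cyclic_successor_vershik y n).
Qed.

End VershikMap.

(** * Readings *)

Definition reads (B C : bratteli) (alpha : bpath C -> bpath B) n l
    (u : vertex C l -> seq (vertex B n)) : Prop :=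
  exists2 g : span0 (edges C) l -> span0 (edges B) n,
    forall z, prefix (alpha z) n = g (prefix z l)
  & forall w, [seq g p | p <- tower C l w] = spread (span0 (edges B) n) (u w).

Section Reads.
Implicit Types B C D : bratteli.

(** Splitting paths of length [m] at level [n], the map on prefixes is the first component, and
    [fibre_comp1] lists these components. *)
Lemma reads_id B n m : n <= m -> reads id (word (span (edges B) n m)).
Proof.
move=> /(@span0_split B)[h [hi hx]].
have [[k hK kK] _ _ _] := hi.
exists (fun p => (val (k p)).1) => [z|w].
  by have [q <- <-] := hx z; rewrite hK.
rewrite -(is_oiso_fibre w hi) -map_comp -[RHS]fibre_comp1.
by apply: eq_map => p /=; rewrite hK.
Qed.

Lemma reads_comp B C D (alpha : bpath C -> bpath B) (beta : bpath D -> bpath C)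
    n l m (u : vertex C l -> seq (vertex B n)) (t : vertex D m -> seq (vertex C l)) :
  reads alpha u -> reads beta t ->
  reads (alpha \o beta) (fun w => flatten [seq u v | v <- t w]).
Proof.
move=> [g ag gu] [k bk kt]; exists (g \o k) => [z /=|w]; first by rewrite ag bk.
rewrite (map_comp g k) kt map_flatten spread_flatten -!map_comp.
by congr flatten; exact/eq_map.
Qed.

Lemma eq_reads B C (alpha : bpath C -> bpath B) n l
    (u t : vertex C l -> seq (vertex B n)) :
  u =1 t -> reads alpha u -> reads alpha t.
Proof. by move=> ut [g ag gu]; exists g => // w; rewrite gu ut. Qed.

(** Every finite path is a prefix, so [alpha] determines the map on prefixes; [spread_inj] then
    recovers the words. *)
Lemma reads_unique B C (alpha : bpath C -> bpath B) n l
    (u t : vertex C l -> seq (vertex B n)) :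
  reads alpha u -> reads alpha t -> u =1 t.
Proof.
move=> [g ag gu] [k ak kt] w; apply: (spread_inj (@span0_rng_surj B n)).
rewrite -gu -kt; apply: eq_map => p.
by have [z <-] := prefix_surj p; rewrite -ag ak.
Qed.

(** Both maps list the same spread along each tower, so they agree floor by floor. *)
Lemma reads_prefix B C (alpha beta : bpath C -> bpath B) n l
    (u : vertex C l -> seq (vertex B n)) z :
  reads alpha u -> reads beta u -> prefix (alpha z) n = prefix (beta z) n.
Proof.
move=> [g -> gu] [k -> ku]; set p := prefix z l.
have /eq_in_map -> // : [seq g q | q <- tower C l (rng p)] =
  [seq k q | q <- tower C l (rng p)] by rewrite gu ku.
by rewrite mem_fibre.
Qed.

Lemma reads_neq0 B C (alpha : bpath C -> bpath B) n l
    (u : vertex C l -> seq (vertex B n)) w :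
  reads alpha u -> u w <> [::].
Proof.
move=> [g _ gu]; move: (gu w) => /[swap] ->.
by have := fibre_neq0 (span0_rng_surj w); case: (fibre _ _).
Qed.

Lemma reads_continuous B C (alpha : bpath C -> bpath B) :
  (forall n, exists l (u : vertex C l -> seq (vertex B n)), reads alpha u) ->
  continuous alpha.
Proof.
move=> ar x A /nbhs_bpathP[n nA]; have [l [u [g ag _]]] := ar n.
by apply: filterS (nbhs_prefix x l) => z /= zx; apply: nA; rewrite !ag zx.
Qed.

Lemma reads_pm_map B C (f : premorphism B C) n :
  reads (pm_map f) (word (pm_edges f n)).
Proof.
have [h hi] := level_iso_ex f n; rewrite /level_iso in hi.
set l := pm_level f n in h hi.
(* Since [pm_edges f 0] is a singleton, composing with it on the left does not change the paths of
   [C]; [q] is this order-preserving identification. *)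
have start_ex (p : span0 (edges C) l) :
    exists q : pm_edges f 0 \oe span (edges C) 0 l, (val q).2 = p.
  have [z <-] := prefix_surj p; exact: start_edge.
have [q qE] := choice start_ex.
have qK q' : q (val q').2 = q' by apply: start_edge_inj; exact: qE.
have q_inj : injective q by move=> p p' pp'; rewrite -(qE p) pp' qE.
have fibre_q w : [seq q p | p <- tower C l w] =
    fibre (pm_edges f 0 \oe span (edges C) 0 l) w.
  apply: fibreE.
  - by rewrite (map_inj_uniq q_inj) fibre_uniq.
  - rewrite sorted_map; apply: sub_sorted (fibre_sorted _ w) => p p' pp'.
    rewrite /= /comp_ole !qE pp' (pm_edge0P (val (q p)).1 (val (q p')).1) ole_refl.
    by rewrite !andbT orNb.
  - by move=> q'; rewrite -[q']qK (mem_map q_inj) mem_fibre qK.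
exists (fun p => (val (h (q p))).1) => [z|w]; last first.
  rewrite -[RHS]fibre_comp1 -(is_oiso_fibre w hi) -fibre_q -!map_comp.
  exact: eq_map.
(* [pm_map_graph] says nothing at level 0, where all prefixes coincide anyway. *)
have [n0|n0] := posnP n.
  subst n; apply: (@singleton_eq (vertex B 0)); exact: vertex0_singleton.
have [h' [q' [h'i q'z <-]]] := pm_mapP f z n0.
rewrite (is_oiso_unique h'i hi); congr (val (h _)).1.
by apply: start_edge_inj; rewrite qE.
Qed.

(** The words of the two sides of the square are what [pm_map g] and [pm_map f] read at the same
    pair of levels; by uniqueness of readings, they agree iff the maps have a common reading
    there. *)
Lemma pm_square_reads B C (f g : premorphism B C) n m :
    n <= m -> pm_level f n <= pm_level g m ->
  pm_square f g n m <-> exists u : vertex C (pm_level g m) -> seq (vertex B n),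
    reads (pm_map f) u /\ reads (pm_map g) u.
Proof.
move=> nm fg.
have rg := reads_comp (reads_id B nm) (reads_pm_map g m).
have rf := reads_comp (reads_pm_map f n) (reads_id C fg).
have wg := word_comp (span (edges B) n m) (pm_edges g m).
have wf := word_comp (pm_edges f n) (span (edges C) (pm_level f n) (pm_level g m)).
rewrite /pm_square oisoP; split=> [E|[u [fu gu]] w].
  eexists; split; first exact: rf.
  by apply: eq_reads rg => w; rewrite -wg E wf.
by rewrite wf wg (reads_unique rg gu) (reads_unique rf fu).
Qed.

Lemma pm_level_le B C (f : premorphism B C) n m :
  n <= m -> pm_level f n <= pm_level f m.
Proof. exact: (homo_leq leqnn leq_trans (pm_le f)). Qed.

Lemma pm_level_cofinal B C (f g : premorphism B C) n :
  exists m, n < m /\ pm_level f n < pm_level g m.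
Proof.
(* Exceeding [pm_level g n] as well forces [n < m], by monotonicity of the levels. *)
have [m] := pm_unbounded g (maxn (pm_level f n) (pm_level g n)).
rewrite -/(pm_level g m) gtn_max => /andP[fm gm]; exists m; split=> //.
by rewrite ltnNge; apply/negP => /(pm_level_le g); rewrite leqNgt gm.
Qed.

Lemma pm_equivP B C (f g : premorphism B C) : pm_equiv f g <-> pm_map f = pm_map g.
Proof.
split=> [[n [m [nm mn fg fgsq _]]]|fg].
  have kn k : k <= n k.
    elim: k => // k /leq_ltn_trans; apply.
    by have /andP[_ /ltn_trans] := nm k; apply.
  apply/funext => z; apply: prefix_inj => k; exists (n k) => //.
  have /andP[_ nmk] := nm k; have /andP[fgk _] := fg k.
  have [u [fu gu]] := (pm_square_reads (ltnW nmk) (ltnW fgk)).1 (fgsq k).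
  exact: reads_prefix fu gu.
have sq (f' g' : premorphism B C) i j : pm_map f' = pm_map g' ->
    i < j -> pm_level f' i < pm_level g' j -> pm_square f' g' i j.
  move=> fg' ij lij; apply: (pm_square_reads (ltnW ij) (ltnW lij)).2.
  have rf := reads_comp (reads_pm_map f' i) (reads_id C (ltnW lij)).
  by exists (fun w => flatten [seq word (pm_edges f' i) v | v <-
    word (span (edges C) (pm_level f' i) (pm_level g' j)) w]); rewrite -fg'.
have [a aP] := choice (pm_level_cofinal f g).
have [b bP] := choice (pm_level_cofinal g f).
(* The indices alternate between [a] and [b], starting from 1 because they must be positive. *)
pose n k := iter k (b \o a) 1.
exists n, (a \o n); split=> k /=.
- rewrite (aP _).1 andbT; case: k => //= k.
  exact: leq_ltn_trans (bP _).1.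
- exact: (bP _).1.
- by rewrite (aP _).2 (bP _).2.
- exact: sq fg (aP _).1 (aP _).2.
- exact: sq (esym fg) (bP _).1 (bP _).2.
Qed.

End Reads.

Section ReadsVershik.
Variables B C : proper_bratteli.
Variable alpha : bpath C -> bpath B.

(** The image of each tower is a sweep. Inside a tower, consecutive floors therefore go to cyclic
    successors; between towers, the top floor goes to a maximal prefix and the bottom floor to a
    minimal one. *)
Lemma reads_vershik n l (u : vertex C l -> seq (vertex B n)) z : reads alpha u ->
  cyclic_successor (prefix (alpha z) n) (prefix (alpha (vershik z)) n) /\
  (maximal_edge (prefix z l) -> maximal_edge (prefix (alpha z) n)).
Proof.
move=> ru; have [g ag gu] := ru; rewrite !ag.
have gsweep w : sweep [seq g p | p <- tower C l w].
  by rewrite gu; apply: sweep_spread (reads_neq0 ru); exact: span0_rng_surj.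
have := cyclic_successor_vershik z l; set p := prefix z l.
set p' := prefix _ l => H.
have [s1 [s2 Ep]] : exists s1 s2, tower C l (rng p) = s1 ++ p :: s2.
  have : p \in tower C l (rng p) by rewrite mem_fibre.
  by case/splitPr => s1 s2; exists s1, s2.
have [a [s [Ea am pas lm]]] := fibreP (span0_rng_surj (rng p)).
have gmax : maximal_edge p -> maximal_edge (g p).
  move=> pm; have [b [t [Eb _ _ bm]]] := gsweep (rng p).
  suff -> : g p = last b t by [].
  have lr : rng (last a s) = rng p.
    by apply/eqP; rewrite -mem_fibre Ea mem_last.
  move: Eb; rewrite Ea /= => -[<- <-]; rewrite last_map.
  by rewrite (maximal_edge_inj pm lm).
split=> //; move: H => [[pm p'm]|pp'].
  left; split; first exact: gmax.
  have [a' [s' [Ea' a'm _ _]]] := fibreP (span0_rng_surj (rng p')).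
  have a'r : rng a' = rng p' by apply/eqP; rewrite -mem_fibre Ea' mem_head.
  have [b [t [Eb bm _ _]]] := gsweep (rng p').
  move: Eb; rewrite Ea' /= => -[E _].
  by rewrite -(minimal_edge_inj a'm p'm a'r) E.
(* As [p] has a successor it is not the top floor, and the next floor [b] is that successor; so
   [g p] and [g b] are adjacent in the sweep. *)
case: s2 Ep => [|b s2] Ep.
  case: (successor_edge_nmax pp'); suff -> : p = last a s by [].
  by rewrite -[last a s]/(last a (a :: s)) -Ea Ep last_cat.
have pb : successor_edge p b.
  have := fibre_successor (F := span0 (edges C) l) (t := rng p) (i := size s1) p.
  have E1 : nth p (s1 ++ p :: b :: s2) (size s1) = p.
    by rewrite nth_cat ltnn subnn.
  have E2 : nth p (s1 ++ p :: b :: s2) (size s1).+1 = b.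
    by rewrite nth_cat ltnNge leqnSn /= subSnn.
  by rewrite Ep E1 E2; apply; rewrite size_cat /= !addnS !ltnS leq_addr.
rewrite (successor_edge_inj pp' pb).
have [c [t [Ec _ ct _]]] := gsweep (rng p).
move: Ec; rewrite Ep map_cat /=; case: s1 {Ep} => [|c' s1] /= [cE tE].
  by move: ct; rewrite -cE -tE /= => /andP[/asboolP].
by move: ct; rewrite -tE cat_path /= => /and3P[_ _ /andP[/asboolP]].
Qed.

Hypothesis alpha_reads :
  forall n, exists l (u : vertex C l -> seq (vertex B n)), reads alpha u.

Lemma reads_equivariant z : alpha (vershik z) = vershik (alpha z).
Proof.
by apply: vershik_unique => n; have [l [u /(reads_vershik z)[]]] := alpha_reads n.
Qed.

Lemma reads_max_path z : max_path z -> max_path (alpha z).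
Proof.
move=> /max_pathP zm; apply/max_pathP => n.
by have [l [u /(reads_vershik z)[_]]] := alpha_reads n; apply.
Qed.

End ReadsVershik.

(** * From factor maps to premorphisms *)

Section WordEdges.
Context {S T : finType} (u : T -> seq S).

(** Edges are positions in the words, which realizes any prescribed words by an ordered edge set. *)
Definition word_edge : finType := {t : T & 'I_(size (u t))}.

Definition word_src (e : word_edge) : S := tnth (in_tuple (u (tag e))) (tagged e).

Definition word_ole (e e' : word_edge) : bool :=
  (tag e == tag e') && (tagged e <= tagged e').

Fact word_ole_refl : reflexive word_ole.
Proof. by move=> e; rewrite /word_ole eqxx leqnn. Qed.

Fact word_ole_anti : antisymmetric word_ole.
Proof.
move=> [t i] [t' i'] /andP[/andP[/= /eqP tt']]; subst t' => /= ii' /andP[_ i'i].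
by congr existT; apply/val_inj/anti_leq; rewrite ii'.
Qed.

Fact word_ole_trans : transitive word_ole.
Proof.
move=> e e' e'' /andP[/eqP tt le] /andP[/eqP tt' le']; apply/andP.
by split; [rewrite tt tt'|exact: leq_trans le'].
Qed.

Fact word_ole_comparable e e' :
  word_ole e e' || word_ole e' e = (tag e == tag e').
Proof. by rewrite /word_ole (eq_sym (tag e')) -andb_orr leq_total andbT. Qed.

Definition word_oedges : oedges S T :=
  OEdges word_src word_ole_refl word_ole_anti word_ole_trans word_ole_comparable.

Lemma word_word_oedges t : word word_oedges t = u t.
Proof.
have tag_inj : injective (fun i : 'I_(size (u t)) => existT _ t i : word_oedges).
  by move=> i j /eqP; rewrite -tag_eqE /tag_eq eqxx /= tagged_asE => /eqP.
rewrite /word -(@fibreE _ _ word_oedges t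
  [seq (existT _ t i : word_oedges) | i <- enum 'I_(size (u t))]).
- rewrite -map_comp; rewrite -[RHS](map_tnth_enum (in_tuple (u t))).
  exact: eq_map.
- by rewrite map_inj_uniq// enum_uniq.
- rewrite sorted_map.
  have : sorted leq [seq val i | i <- enum 'I_(size (u t))].
    by rewrite val_enum_ord iota_sorted.
  by rewrite sorted_map; apply: sub_sorted => i j; rewrite /= /word_ole eqxx.
- move=> [t' i]; apply/mapP/eqP => [[j _ /(congr1 tag)] //|/= tt']; subst t'.
  by exists i; rewrite ?mem_enum.
Qed.

End WordEdges.

Lemma fibre_id_oedges (S : finType) (s : S) : fibre (id_oedges S) s = [:: s].
Proof. by apply/esym/(@fibreE _ _ (id_oedges S)) => //= e; rewrite inE. Qed.

Lemma word_spanS B n :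
  word (span (edges B) n n.+1) =1 word (edges B n).
Proof.
move=> v; rewrite spanS// spankk word_comp -[RHS](flatten_seq1 (word (edges B n) v)).
by congr flatten; apply: eq_map => s; rewrite /word fibre_id_oedges.
Qed.

Lemma card_oedges (S T : finType) (F : oedges S T) t :
  (forall e : F, rng e = t) -> #|F| = size (word F t).
Proof.
move=> rt; rewrite size_map size_sort (eq_filter (a2 := predT)).
  by rewrite filter_predT cardE.
by move=> e; rewrite rt eqxx.
Qed.

Lemma reads0 (B C : bratteli) (alpha : bpath C -> bpath B) (v : vertex B 0) :
  reads alpha (fun _ : vertex C 0 => [:: v]).
Proof.
exists (fun=> v) => [z|w]; last by rewrite /spread /= !fibre_id_oedges.
by apply: (@singleton_eq (vertex B 0)); exact: vertex0_singleton.
Qed.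

Section Realization.
Variables B C : proper_bratteli.
Variable alpha : bpath C -> bpath B.
Hypothesis alphaE : forall z, alpha (vershik z) = vershik (alpha z).

Lemma reads_exists n l :
    (forall z z', prefix z l = prefix z' l ->
       prefix (alpha z) n = prefix (alpha z') n) ->
    (forall z, minimal_edge (prefix z l) -> minimal_edge (prefix (alpha z) n)) ->
  exists u : vertex C l -> seq (vertex B n), reads alpha u.
Proof.
move=> a_prefix a_min; have [e eE] := choice (@prefix_surj C l).
pose g p := prefix (alpha (e p)) n.
have ag z : prefix (alpha z) n = g (prefix z l) by apply: a_prefix; rewrite eE.
have iterE N z : alpha (iter N (@vershik C) z) = iter N (@vershik B) (alpha z).
  by elim: N => //= N IH; rewrite alphaE IH.
have traceE N z : trace n (alpha z) N = [seq g p | p <- trace l z N].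
  rewrite /trace -map_comp; elim: N z => //= N IH z.
  by rewrite ag -alphaE IH.
suff u_ex w : exists u, [seq g p | p <- tower C l w] = spread (span0 (edges B) n) u.
  by have [u uE] := choice u_ex; exists u; exists g.
have [p [s [E pm _ _]]] := fibreP (span0_rng_surj w).
have pw : rng p = w by apply/eqP; rewrite -mem_fibre E mem_head.
have zm : minimal_edge (prefix (e p) l) by rewrite eE.
(* The tower over [w] is the trace of [e p] over its full height. At both ends the prefix is
   minimal, and [a_min] transfers this to the image orbit. *)
have := trace_tower zm; rewrite eE pw => <-; rewrite -traceE.
apply: trace_spread; first exact: a_min.
rewrite -iterE; apply: a_min.
by have := minimal_iter_tower zm; rewrite eE pw.
Qed.

Hypothesis alpha_cont : continuous alpha.
Hypothesis alpha_max : forall z, max_path z -> max_path (alpha z).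
Hypothesis C_compact : compact [set: bpath C].

(** Compactness in its near-covering form: bounds that hold near each point become one bound for the
    whole space. *)
Lemma compact_prefix (P : nat -> bpath C -> Prop) :
    (forall z, exists l, forall i z', l <= i -> prefix z' l = prefix z l -> P i z') ->
  exists L, forall l z, L <= l -> P l z.
Proof.
move=> Pl; have := (compact_near_coveringP _).1 C_compact nat \oo P _.
case=> [z _|L _ LP].
  have [l lP] := Pl z.
  exists ([set z' | prefix z' l = prefix z l], [set i | l <= i]) => /=.
    by split; [exact: nbhs_prefix|exact: nbhs_infty_ge].
  by move=> [z' i] /= [zz' li]; exact: lP.
by exists L => l z /LP; exact.
Qed.

(** The minimal path is the Vershik image of the maximal one, which [alpha] respects. *)
Lemma min_path_alpha z : min_path z -> min_path (alpha z).
Proof.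
move=> zm; have [x [xm _]] := max_path_unique C.
have [t [_ tu]] := min_path_unique C.
rewrite -(tu z zm) (tu (vershik x)) ?alphaE; last exact: vershik_max_path.
exact/vershik_max_path/alpha_max.
Qed.

Lemma reads_eventually n : exists L, forall l, L <= l ->
  exists u : vertex C l -> seq (vertex B n), reads alpha u.
Proof.
have [L LP] : exists L, forall l z, L <= l -> forall z', prefix z' l = prefix z l ->
    prefix (alpha z') n = prefix (alpha z) n.
  apply: (@compact_prefix (fun l z => forall z', prefix z' l = prefix z l ->
    prefix (alpha z') n = prefix (alpha z) n)) => x.
  have [l lP] := nbhs_bpathP (alpha_cont (nbhs_prefix (alpha x) n)).
  exists l => i z li zx z' /(prefix_le li) z'z.
  by rewrite lP ?z'z// lP.
have [zmin [zmin_min zu]] := min_path_unique C.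
(* Any path other than [zmin] shows a non-minimal edge at a finite stage, so a long enough minimal
   prefix begins like [zmin], whose image is minimal. *)
have [M MP] : exists M, forall l z, M <= l -> minimal_edge (prefix z l) ->
    prefix z L = prefix zmin L.
  apply: (@compact_prefix (fun l z => minimal_edge (prefix z l) ->
    prefix z L = prefix zmin L)) => x.
  have [/zu <-|/min_pathP/existsNP[k xk]] := pselect (min_path x).
    by exists L.
  exists k => i z ki zx /minimal_prefix zm; case: xk; rewrite -zx.
  by apply/minimal_prefix => j jk; apply: zm; exact: leq_trans ki.
exists (maxn L M) => l; rewrite geq_max => /andP[Ll Ml].
apply: reads_exists => [z z'|z zm]; first exact: LP.
rewrite (LP L zmin)//; first by have /min_pathP := min_path_alpha zmin_min; exact.
exact: MP zm.
Qed.

Hypothesis alpha_surj : set_surj setT setT alpha.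

Lemma premorphism_of_reads : exists f : premorphism B C, pm_map f = alpha.
Proof.
have [L LP] := choice reads_eventually.
(* [next n] is the level of index [n.+1]: the last summand puts it above the threshold [L n.+1], and
   the added ones make the levels strictly increasing. *)
pose next n := \sum_(i < n.+1) (L i.+1).+1.
have [v0 _] : exists v : vertex B 0, True.
  by have /card_gt0P[v _] := vertex_neq0 B 0; exists v.
have u_ex n : exists u : vertex C (from0 next n) -> seq (vertex B n), reads alpha u.
  case: n => [|n]; first by exists (fun=> [:: v0]); exact: reads0.
  by apply: LP; rewrite /= /next big_ord_recr /= -addSnnS leq_addl.
pose u n := projT1 (cid (u_ex n)).
have uP n : reads alpha (u n) := projT2 (cid (u_ex n)).
pose F n := word_oedges (u n).
have next_le n : from0 next n <= from0 next n.+1.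
  by case: n => // n; rewrite /= /next [leqRHS]big_ord_recr leq_addr.
have next_ge n : n <= from0 next n.
  elim: n => // n IH; apply: leq_ltn_trans IH _; case: n => [|n].
    by rewrite /= /next big_ord1.
  by rewrite /= /next [ltnRHS]big_ord_recr /= addnS ltnS leq_addr.
have unbounded N : exists n, N < from0 next n by exists N.+1; exact: next_ge.
(* Extend a path ending at [v] to an infinite one and lift it through the surjection [alpha]: then
   [v] occurs in the word of the tower containing the lift. *)
have src_ex n v : exists e : F n, src e = v.
  have [p <-] := span0_rng_surj v; have [y <-] := prefix_surj p.
  have [z _ <-] := alpha_surj (I : setT y); have [g -> gu] := uP n.
  set q := prefix z _.
  have : g q \in spread (span0 (edges B) n) (u n (rng q)).
    by rewrite -gu map_f// mem_fibre.
  move=> /rng_spread; rewrite -(word_word_oedges (u n)) => /mapP[e _ ->].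
  by exists e.
have rng_ex n w : exists e : F n, rng e = w.
  have := reads_neq0 (w := w) (uP n); rewrite -(word_word_oedges (u n)) /word.
  case E : (fibre _ w) => [//|e s] _; exists e; apply/eqP.
  by rewrite -mem_fibre E mem_head.
have neq0 n : 0 < #|F n|.
  have /card_gt0P[v _] := vertex_neq0 B n; have [e _] := src_ex n v.
  by apply/card_gt0P; exists e.
have singleton : #|F 0| = 1.
  have [w _] : exists w : vertex C 0, True.
    by have /card_gt0P[w _] := vertex_neq0 C 0; exists w.
  rewrite (card_oedges (t := w)) => [|e].
    by rewrite word_word_oedges (reads_unique (uP 0) (reads0 alpha v0)).
  by apply: singleton_eq; exact: vertex0_singleton.
(* Both sides spell readings of [alpha] at the same levels, so [reads_unique] applies. *)
have commute n : oiso (edges B n \oe F n.+1)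
    (F n \oe span (edges C) (from0 next n) (from0 next n.+1)).
  apply/oisoP => w; rewrite !word_comp word_word_oedges.
  rewrite -(eq_map (@word_spanS B n)) [in RHS](eq_map (word_word_oedges (u n))).
  exact: (reads_unique (reads_comp (reads_id B (leqnSn n)) (uP n.+1))
    (reads_comp (uP n) (reads_id C (next_le n)))).
pose f := Premorphism next_le unbounded neq0 src_ex rng_ex singleton commute.
exists f; apply/funext => z; apply: prefix_inj => n; exists n => //.
apply: reads_prefix (reads_pm_map f n) _.
by apply: eq_reads (uP n) => w; rewrite -[LHS](word_word_oedges (u n)).
Qed.

End Realization.

(** * The correspondence *)

Lemma sval_inj (T : Type) (P : T -> Prop) : injective (@sval T P).
Proof. by move=> [a pa] [b pb] /= ab; exact: eq_exist. Qed.

Section Conjugacies.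
Variables (X Y : topologicalType) (phi : X -> X) (psi : Y -> Y) (x : X) (y : Y).
Variables C B : proper_bratteli.
Hypotheses (hX : cantor_minimal phi) (hY : cantor_minimal psi).
Variables (thetaX : X -> bpath C) (thetaY : Y -> bpath B).
Hypotheses (cX : pointed_conjugacy phi x thetaX).
Hypotheses (cY : pointed_conjugacy psi y thetaY).

Lemma bpath_compact : compact [set: bpath C].
Proof.
have [[h [h' [hK _ _ h'c]]] _] := hX; have [[iX [_ iXK tc _]] _ _] := cX.
have -> : [set: bpath C] = (thetaX \o h') @` [set: cantor_space].
  apply/seteqP; split=> // z _; exists (h (iX z)) => //=.
  by rewrite hK iXK.
apply: continuous_compact cantor_space_compact.
by apply: continuous_subspaceT => z; apply: continuous_comp (h'c z) (tc _).
Qed.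

Lemma factor_premorphism (alpha : X -> Y) :
  factor_map phi psi alpha -> alpha x = y ->
  exists f : premorphism B C, forall z, thetaY (alpha z) = pm_map f (thetaX z).
Proof.
move=> [ac asurj aE] axy.
have [[iX [iK Ki tc ic]] tE tmax] := cX; have [[jY [jK Kj sc jc]] sE smax] := cY.
have [w [wm wu]] := max_path_unique C.
have [|z|z zm||z _|f fE] := @premorphism_of_reads B C (thetaY \o alpha \o iX).
- move=> z /=; rewrite -sE -aE; congr (thetaY (alpha _)).
  by rewrite -{1}[z]Ki -tE iK.
- by apply: continuous_comp (ic z) _; apply: continuous_comp (ac _) (sc _).
- by rewrite -(wu z zm) (wu _ tmax) /= iK axy.
- exact: bpath_compact.
- have [t _ tz] := asurj (jY z) I; exists (thetaX t) => //=.
  by rewrite iK tz Kj.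
by exists f => z; rewrite fE /= iK.
Qed.

Lemma premorphism_factor (f : premorphism B C) : exists alpha : X -> Y,
  [/\ factor_map phi psi alpha, alpha x = y
    & forall z, thetaY (alpha z) = pm_map f (thetaX z)].
Proof.
have [[iX [iK Ki tc ic]] tE tmax] := cX; have [[jY [jK Kj sc jc]] sE smax] := cY.
have [_ [[phi' [phiK phi'K _ _]] _]] := hX; have [_ [_ psi_min]] := hY.
have f_reads n : exists l (u : vertex C l -> seq (vertex B n)), reads (pm_map f) u.
  by exists (pm_level f n), (word (pm_edges f n)); exact: reads_pm_map.
have fc := reads_continuous f_reads.
pose alpha := jY \o pm_map f \o thetaX.
have alphaP z : thetaY (alpha z) = pm_map f (thetaX z) by rewrite /alpha /= Kj.
have alpha_inj a b : thetaY a = thetaY b -> a = b by exact: (can_inj jK).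
have alphaE z : alpha (phi z) = psi (alpha z).
  by apply: alpha_inj; rewrite sE !alphaP tE (reads_equivariant f_reads).
have ac : continuous alpha.
  move=> z; apply: continuous_comp (tc z) _.
  by apply: continuous_comp (fc _) (jc _).
have axy : alpha x = y.
  have [w [wm wu]] := max_path_unique B.
  apply: alpha_inj; rewrite alphaP -(wu _ smax).
  exact/esym/wu/(reads_max_path f_reads).
exists alpha; split=> //; split=> //.
(* Surjectivity comes from minimality of [psi]: the image of [alpha] is non-empty, invariant, and
   closed as the preimage of a compact subset of a Hausdorff path space. *)
have rE : alpha @` [set: X] = thetaY @^-1` (pm_map f @` [set: bpath C]).
  apply/seteqP; split=> [_ [z _ <-]|z [w _ wz]].
    by exists (thetaX z) => //; rewrite alphaP.
  exists (iX w) => //; apply: alpha_inj.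
  by rewrite alphaP Ki.
have rclosed : closed (alpha @` [set: X]).
  rewrite rE; apply: closed_comp => [z _|]; first exact: sc.
  apply: compact_closed; first exact: bpath_hausdorff.
  apply: continuous_compact bpath_compact.
  exact: continuous_subspaceT.
have [|r0|rT] := psi_min _ rclosed.
- apply/seteqP; split=> [_ [_ [z _ <-] <-]|_ [z _ <-]].
    by exists (phi z).
  by exists (alpha (phi' z)); [exists (phi' z)|rewrite -alphaE phi'K].
- have : (alpha @` [set: X]) y by exists x.
  by rewrite r0.
by move=> z _; rewrite rT.
Qed.

Lemma factor_map_class (f g : premorphism B C) :
  pm_equiv f g <-> forall z, pm_map f (thetaX z) = pm_map g (thetaX z).
Proof.
rewrite pm_equivP; split=> [->//|fg]; apply/funext => z.
by have [[iX [_ Ki _ _]] _ _] := cX; rewrite -[z]Ki.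
Qed.

Lemma class_factor_bijection :
  exists Phi : pm_classes B C -> pointed_factor_maps phi psi x y,
    bijective Phi /\
    forall (f : premorphism B C) (z : X),
      thetaY (sval (Phi (pm_class f)) z) = pm_map f (thetaX z).
Proof.
have [[jY [jK _ _ _]] _ _] := cY.
(* [Phi A] is specified by the premorphisms inducing it, which are exactly the members of [A],
   independently of a representative. The inverse sends a factor map to the class of all
   premorphisms inducing it. *)
have Phi_ex (A : pm_classes B C) : exists a : pointed_factor_maps phi psi x y,
    forall f, sval A f <-> forall z, thetaY (sval a z) = pm_map f (thetaX z).
  have [f fA] := svalP A; have [alpha [af axy aP]] := premorphism_factor f.
  exists (exist _ alpha (conj af axy)) => g.
  rewrite fA factor_map_class; split=> fg z; first by rewrite aP.
  by rewrite -aP fg.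
pose Phi A := projT1 (cid (Phi_ex A)).
have PhiP A f : sval A f <->
    forall z, thetaY (sval (Phi A) z) = pm_map f (thetaX z).
  exact: (projT2 (cid (Phi_ex A))).
have PsiP (a : pointed_factor_maps phi psi x y) : exists f : premorphism B C,
    (fun g => forall z, thetaY (sval a z) = pm_map g (thetaX z)) = pm_equiv f.
  have [f fa] := factor_premorphism (svalP a).1 (svalP a).2.
  exists f; apply/funext => g; apply/propext; rewrite factor_map_class.
  by split=> fg z; [rewrite -fa|rewrite fa].
pose Psi a : pm_classes B C := exist _ _ (PsiP a).
exists Phi; split; last first.
  by move=> f; apply/PhiP; rewrite /=; apply/factor_map_class.
exists Psi => [A|a].
  apply: sval_inj; apply/funext => f; apply/propext.
  exact: iff_sym (PhiP A f).
have [f fa] := factor_premorphism (svalP a).1 (svalP a).2.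
apply: sval_inj; apply/funext => z; apply: (can_inj jK).
by rewrite fa; apply: ((PhiP (Psi a) f).1).
Qed.

End Conjugacies.

Theorem proposition4p6 (X Y : topologicalType) (phi : X -> X) (psi : Y -> Y)
    (x : X) (y : Y) (C B : proper_bratteli)
    (hX : cantor_minimal phi) (hY : cantor_minimal psi)
    (hC : bv_model phi x C) (hB : bv_model psi y B) :
  ((exists alpha : X -> Y, factor_map phi psi alpha /\ alpha x = y) <->
   inhabited (premorphism B C)) /\
  (forall (thetaX : X -> bpath C) (thetaY : Y -> bpath B),
    pointed_conjugacy phi x thetaX -> pointed_conjugacy psi y thetaY ->
    exists Phi : pm_classes B C -> pointed_factor_maps phi psi x y,
      bijective Phi /\
      forall (f : premorphism B C) (z : X),
        thetaY (sval (Phi (pm_class f)) z) = pm_map f (thetaX z)).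
Proof.
split; last by move=> thetaX thetaY; exact: class_factor_bijection.
have [[thetaX cX] [thetaY cY]] := (hC, hB); split=> [[alpha [af axy]]|[f]].
  by have [f _] := factor_premorphism hX cX cY af axy.
by have [alpha [af axy _]] := premorphism_factor hX hY cX cY f; exists alpha.
Qed.
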